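(* Given $\varepsilon>0$, let $K$ be a positive integer and $C_\beta,C_\varepsilon>0$. Set $\rho_k=\beta_k=\frac{C_\beta}{K\varepsilon}$ and $\varepsilon_k=\frac{\varepsilon}{2}\frac{C_\varepsilon}{C_\beta}$ for $0\le k<K$, and run the inexact augmented Lagrangian method (iALM, see context) with $y^0=0$, $z^0=0$. Let $\bar x^{K}=\frac{\sum_{t=0}^{K-1}\rho_tx^{t+1}}{\sum_{t=0}^{K-1}\rho_t}$. Then $$\big|f_0(\bar x^{K})-f_0(x^* )\big|\le\frac{\varepsilon\big(2\|y^*\|^2+2\|z^*\|^2\big)}{C_\beta}+\frac{\varepsilon}{2}\frac{C_\varepsilon}{C_\beta},$$ $$\|A\bar x^{K}-b\|+\big\|[f(\bar x^{K})]_+\big\|\le\frac{\varepsilon\big[(1+\|y^*\|)^2+(1+\|z^*\|)^2\big]}{2C_\beta}+\frac{\varepsilon}{2}\frac{C_\varepsilon}{C_\beta}.$$ Assume moreover $\mu\le\frac{L_0}{4}$. Then iALM, with subproblems solved by Nesterov's optimal first-order method as described in the context, can produce $\bar x^K$ by evaluating the gradients of $g,f_i$, $i\in[m]$, at most $T_K$ times, where $$T_K\le\left\lceil2DK\sqrt{\frac{C_\beta}{C_\varepsilon}}\left(\sqrt{\frac{L_*}{\varepsilon}}+\frac1\varepsilon\sqrt{\frac{C_\beta H}{K}}\right)+K\right\rceil\quad\text{if }\mu=0,$$ and $$T_K\le\left\lceil2K\left(\sqrt{\frac{L_*}{\mu}}+\sqrt{\frac{C_\beta H}{\mu K\varepsilon}}\right)\log\left(\frac{D^2C_\beta}{C_\varepsilon}\Big(\frac{L_*+\mu}{\varepsilon}+\frac{C_\beta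 H}{K\varepsilon^2}\Big)\right)+K\right\rceil\quad\text{if }\mu>0.$$
   Context: Problem: $\min_{x\in X}f_0(x)$ s.t. $Ax=b$, $f_i(x)\le0$, $i\in[m]=\{1,\dots,m\}$, where $X\subseteq\mathbb R^n$ is closed and convex, $A$ a matrix, $b$ a vector, $f_0=g+h$ with $g$ convex differentiable and $h:\mathbb R^n\to\mathbb R\cup\{+\infty\}$ convex, $f_1,\dots,f_m$ convex differentiable; $\|\nabla g(\hat x)-\nabla g(\tilde x)\|\le L_0\|\hat x-\tilde x\|$ and $\|\nabla f_i(\hat x)-\nabla f_i(\tilde x)\|\le L_i\|\hat x-\tilde x\|$ for $\hat x,\tilde x\in\mathrm{dom}(h)\cap X$; $\mathrm{dom}(h)\cap X$ is bounded with diameter $D$. $g$ is strongly convex with modulus $\mu\ge0$ ($\mu=0$ meaning merely convex). $\|\cdot\|$ is the Euclidean norm for vectors and the spectral norm for matrices, $f(x)=(f_1(x),\dots,f_m(x))$, $[\cdot]_+$ is the componentwise positive part. $B_1,\dots,B_m$ are constants with $\max(|f_i(x)|,\|\nabla f_i(x)\|)\le B_i$ and $|f_i(\hat x)-f_i(\tilde x)|\le B_i\|\hat x-\tilde x\|$ for $x,\hat x,\tilde x\in\mathrm{dom}(h)\cap X$. $(x^*,y^*,z^* )$ is a KKT point (assumed to exist): $0\in\partial f_0(x^* )+N_X(x^* )+A^\top y^*+\sum_iz_i^*\nabla f_i(x^* )$ ($N_X$ the normal cone), $Ax^*=b$, $x^*\in X$, $z_i^*\ge0$, $f_i(x^* )\le0$,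 $z_i^*f_i(x^* )=0$ for all $i$. Constants: $\ell=(L_1,\dots,L_m)$, $H=\|A^\top A\|+\sum_{i=1}^mB_i(B_i+L_i)$, $L_*=L_0+\|\ell\|\big(\|y^*\|+2\|z^*\|+\sqrt{C_\varepsilon}\big)$. Augmented Lagrangian: $\mathcal L_\beta(x,y,z)=f_0(x)+y^\top(Ax-b)+\frac\beta2\|Ax-b\|^2+\sum_{i=1}^m\psi_\beta(f_i(x),z_i)$, where $\psi_\beta(u,v)=uv+\frac\beta2u^2$ if $\beta u+v\ge0$, and $\psi_\beta(u,v)=-\frac{v^2}{2\beta}$ otherwise. iALM: from $x^0\in\mathrm{dom}(h)\cap X$, $y^0,z^0$, for $k=0,1,\dots$: find $x^{k+1}\in X$ with $\mathcal L_{\beta_k}(x^{k+1},y^k,z^k)\le\min_{x\in X}\mathcal L_{\beta_k}(x,y^k,z^k)+\varepsilon_k$ (assumed to exist for every $k$); set $y^{k+1}=y^k+\rho_k(Ax^{k+1}-b)$, $z_i^{k+1}=z_i^k+\rho_k\max\big(-\frac{z_i^k}{\beta_k},f_i(x^{k+1})\big)$, $i\in[m]$. Subproblem solver (Nesterov's optimal first-order method) for $\min\phi+\psi$, $\phi$ having gradient Lipschitz constant $L_\phi$ and strong convexity modulus $\mu\ge0$: $\hat w^0=w^0$, $\alpha_0=1$ if $\mu=0$ and $\alpha_0=\sqrt{\mu/L_\phi}$ if $\mu>0$, $q=\mu/L_\phi$, and iterate $w^{j+1}=\arg\min_w\langle\nabla\phi(\hat w^j),w\rangle+\frac{L_\phi}2\|w-\hat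 w^j\|^2+\psi(w)$, $\alpha_{j+1}=\frac{q-\alpha_j^2+\sqrt{(q-\alpha_j^2)^2+4\alpha_j^2}}2$, $\hat w^{j+1}=w^{j+1}+\frac{\alpha_j(1-\alpha_j)}{\alpha_j^2+\alpha_{j+1}}(w^{j+1}-w^j)$. In iALM iteration $k$ it is started at $w^0=x^k$ with $\phi=\mathcal L_{\beta_k}(\cdot,y^k,z^k)-h$, $\psi=h+\iota_X$ ($\iota_X$ the indicator function of $X$) and $L_\phi=L_0+\beta_k\|A^\top A\|+\sum_{i=1}^m(\beta_kB_i(B_i+L_i)+L_i|z_i^k|)$, and is stopped once accuracy $\varepsilon_k$ is reached. Each of its iterations counts as one evaluation of the gradients of $g,f_1,\dots,f_m$.
   Formalization: For the bounds on T_K, each φ is also assumed to have L_φ-Lipschitz gradient at extrapolated points x+t(x−x'), x,x'∈dom(h)∩X, t∈[0,1], outside dom(h)∩X (the bound can fail otherwise), and log is replaced by max(0,log), as a negative log cannot bound a count. *)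

(* Defs.v *)
From HB Require Import structures.
From mathcomp Require Import all_boot all_order all_algebra.
From mathcomp Require Import all_classical all_reals all_analysis.

Set Implicit Arguments.
Unset Strict Implicit.
Unset Printing Implicit Defensive.

Import Order.TTheory GRing.Theory Num.Theory.
Import numFieldNormedType.Exports.
Local Open Scope classical_set_scope.
Local Open Scope ring_scope.

(* The library norm on matrices is the max norm, hence the explicit Euclidean
   and spectral norms. *)
Definition dot (R : realType) (n : nat) (u v : 'cV[R]_n) : R :=
  \sum_(i < n) u i 0 * v i 0.

Definition enorm (R : realType) (n : nat) (u : 'cV[R]_n) : R :=
  Num.sqrt (dot u u).

Definition spectral_norm (R : realType) (p n : nat) (M : 'M[R]_(p, n)) : R :=
  sup [set enorm (M *m v) | v in [set v : 'cV[R]_n | enorm v <= 1]].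

Definition diam (R : realType) (n : nat) (C : set 'cV[R]_n) : R :=
  sup [set r | exists u v, [/\ C u, C v & r = enorm (u - v)]].

(* Vector of partial derivatives; it is the gradient because it is only used
   for functions assumed (or provably) differentiable. *)
Definition grad (R : realType) (n : nat) (F : 'cV[R]_n -> R) (x : 'cV[R]_n) :
    'cV[R]_n :=
  \col_i 'D_(delta_mx i 0) F x.

Definition elipschitz_on (R : realType) (n q : nat) (L : R) (S : set 'cV[R]_n)
    (G : 'cV[R]_n -> 'cV[R]_q) : Prop :=
  forall u v, S u -> S v -> enorm (G u - G v) <= L * enorm (u - v).

Definition pos_part (R : realType) (m : nat) (u : 'cV[R]_m) : 'cV[R]_m :=
  \col_i Num.max 0 (u i 0).

(* Modulus mu = 0 is plain convexity. *)
Definition strongly_convex (R : realType) (n : nat) (mu : R)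
    (F : 'cV[R]_n -> R) : Prop :=
  forall (u v : 'cV[R]_n) (t : R), 0 <= t <= 1 ->
    F (t *: u + (1 - t) *: v) <=
      t * F u + (1 - t) * F v - mu / 2 * (t * (1 - t)) * enorm (u - v) ^+ 2.

Definition econvex (R : realType) (n : nat) (F : 'cV[R]_n -> \bar R) : Prop :=
  forall (u v : 'cV[R]_n) (t : R), 0 <= t <= 1 ->
    (F (t *: u + (1 - t) *: v)%R <= t%:E * F u + (1 - t)%:E * F v)%E.

Definition subdifferential (R : realType) (n : nat) (F : 'cV[R]_n -> \bar R)
    (x : 'cV[R]_n) : set 'cV[R]_n :=
  [set v | F x \is a fin_num /\
           forall u, (F x + (dot v (u - x))%:E <= F u)%E].

Definition normal_cone (R : realType) (n : nat) (X : set 'cV[R]_n)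
    (x : 'cV[R]_n) : set 'cV[R]_n :=
  [set v | X x /\ forall u, X u -> dot v (u - x) <= 0].

Definition eindicator (R : realType) (n : nat) (X : set 'cV[R]_n)
    (x : 'cV[R]_n) : \bar R :=
  if `[< X x >] then 0%E else +oo%E.

Definition is_argmin (R : realType) (n : nat) (F : 'cV[R]_n -> \bar R)
    (w : 'cV[R]_n) : Prop :=
  forall u, (F w <= F u)%E.

(* Data of: minimize pg + ph over pX subject to pA x = pb and pf i x <= 0. *)
Record program (R : realType) (n p m : nat) := Program {
  pX : set 'cV[R]_n;
  pA : 'M[R]_(p, n);
  pb : 'cV[R]_p;
  pg : 'cV[R]_n -> R;
  ph : 'cV[R]_n -> \bar R;
  pf : 'I_m -> 'cV[R]_n -> R
}.

Definition objective (R : realType) (n p m : nat) (P : program R n p m)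
    (x : 'cV[R]_n) : \bar R :=
  ((pg P x)%:E + ph P x)%E.

Definition constraints (R : realType) (n p m : nat) (P : program R n p m)
    (x : 'cV[R]_n) : 'cV[R]_m :=
  \col_i pf P i x.

Definition domX (R : realType) (n p m : nat) (P : program R n p m) :
    set 'cV[R]_n :=
  [set x | (ph P x < +oo)%E] `&` pX P.

Definition convex_program (R : realType) (n p m : nat) (P : program R n p m)
    (mu : R) : Prop :=
  [/\ closed (pX P) /\ convex_set (pX P : set (convex_lmodType 'cV[R]_n)),
      0 <= mu /\ strongly_convex mu (pg P),
      forall x, differentiable (pg P) x,
      (forall x, ph P x != -oo%E) /\ econvex (ph P) &
      forall i, convex_function (setT : set (convex_lmodType 'cV[R]_n)) (pf P i)
                /\ forall x, differentiable (pf P i) x].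

Definition regularity_constants (R : realType) (n p m : nat)
    (P : program R n p m) (L0 : R) (L B : 'I_m -> R) : Prop :=
  [/\ 0 <= L0 /\ elipschitz_on L0 (domX P) (grad (pg P)),
      forall i, 0 <= L i /\ elipschitz_on (L i) (domX P) (grad (pf P i)),
      forall i x, domX P x ->
        Num.max `|pf P i x| (enorm (grad (pf P i) x)) <= B i &
      forall i u v, domX P u -> domX P v ->
        `|pf P i u - pf P i v| <= B i * enorm (u - v)].

Definition kkt_point (R : realType) (n p m : nat) (P : program R n p m)
    (x : 'cV[R]_n) (y : 'cV[R]_p) (z : 'cV[R]_m) : Prop :=
  [/\ exists v w, [/\ subdifferential (objective P) x v,
                      normal_cone (pX P) x w &
                      v + w + (pA P)^T *m y
                        + \sum_(i < m) z i 0 *: grad (pf P i) x = 0],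
      pA P *m x = pb P,
      pX P x &
      forall i, [/\ 0 <= z i 0, pf P i x <= 0 & z i 0 * pf P i x = 0]].

Definition psi_beta (R : realType) (beta u v : R) : R :=
  if 0 <= beta * u + v then u * v + beta / 2 * u ^+ 2
  else - (v ^+ 2 / (2 * beta)).

Definition lagrangian_terms (R : realType) (n p m : nat) (P : program R n p m)
    (beta : R) (y : 'cV[R]_p) (z : 'cV[R]_m) (x : 'cV[R]_n) : R :=
  dot y (pA P *m x - pb P) + beta / 2 * enorm (pA P *m x - pb P) ^+ 2
    + \sum_(i < m) psi_beta beta (pf P i x) (z i 0).

Definition aug_lagrangian (R : realType) (n p m : nat) (P : program R n p m)
    (beta : R) (y : 'cV[R]_p) (z : 'cV[R]_m) (x : 'cV[R]_n) : \bar R :=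
  (objective P x + (lagrangian_terms P beta y z x)%:E)%E.

(* The augmented Lagrangian minus h. *)
Definition aug_lagrangian_smooth (R : realType) (n p m : nat)
    (P : program R n p m) (beta : R) (y : 'cV[R]_p) (z : 'cV[R]_m)
    (x : 'cV[R]_n) : R :=
  pg P x + lagrangian_terms P beta y z x.

Definition accurate (R : realType) (n p m : nat) (P : program R n p m)
    (beta : R) (y : 'cV[R]_p) (z : 'cV[R]_m) (eps : R) (x : 'cV[R]_n) : Prop :=
  pX P x /\
  (aug_lagrangian P beta y z x <=
     ereal_inf [set aug_lagrangian P beta y z u | u in pX P] + eps%:E)%E.

Definition update_y (R : realType) (n p m : nat) (P : program R n p m)
    (rho : R) (y : 'cV[R]_p) (x : 'cV[R]_n) : 'cV[R]_p :=
  y + rho *: (pA P *m x - pb P).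

Definition update_z (R : realType) (n p m : nat) (P : program R n p m)
    (rho beta : R) (z : 'cV[R]_m) (x : 'cV[R]_n) : 'cV[R]_m :=
  \col_i (z i 0 + rho * Num.max (- (z i 0 / beta)) (pf P i x)).

(* The first K outer iterations; later terms of the sequences are free. *)
Definition ialm_run (R : realType) (n p m : nat) (P : program R n p m)
    (K : nat) (beta rho eps : nat -> R) (x0 : 'cV[R]_n) (y0 : 'cV[R]_p)
    (z0 : 'cV[R]_m) (x : nat -> 'cV[R]_n) (y : nat -> 'cV[R]_p)
    (z : nat -> 'cV[R]_m) : Prop :=
  [/\ x 0%N = x0, y 0%N = y0, z 0%N = z0 &
      forall k, (k < K)%N ->
        [/\ accurate P (beta k) (y k) (z k) (eps k) (x k.+1),
            y k.+1 = update_y P (rho k) (y k) (x k.+1) &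
            z k.+1 = update_z P (rho k) (beta k) (z k) (x k.+1)]].

Definition weighted_average (R : realType) (n : nat) (K : nat)
    (rho : nat -> R) (x : nat -> 'cV[R]_n) : 'cV[R]_n :=
  (\sum_(t < K) rho t)^-1 *: \sum_(t < K) rho t *: x t.+1.

Definition nesterov_iterates (R : realType) (n : nat) (phi : 'cV[R]_n -> R)
    (psi : 'cV[R]_n -> \bar R) (Lphi mu : R) (w0 : 'cV[R]_n)
    (w what : nat -> 'cV[R]_n) (alpha : nat -> R) : Prop :=
  let q := mu / Lphi in
  [/\ w 0%N = w0, what 0%N = w0,
      alpha 0%N = (if mu == 0 then 1 else Num.sqrt (mu / Lphi)) &
      forall j,
        [/\ is_argmin (fun u => ((dot (grad phi (what j)) u
                + Lphi / 2 * enorm (u - what j) ^+ 2)%:E + psi u)%E) (w j.+1),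
            alpha j.+1 = (q - alpha j ^+ 2
                + Num.sqrt ((q - alpha j ^+ 2) ^+ 2 + 4 * alpha j ^+ 2)) / 2 &
            what j.+1 = w j.+1 + (alpha j * (1 - alpha j)
                / (alpha j ^+ 2 + alpha j.+1)) *: (w j.+1 - w j)]].

(* Extrapolated points contain every search point of the method when the
   iterates lie in C: the extrapolation factor always lies in [0, 1]. *)
Definition extrapolation_region (R : realType) (n : nat) (C : set 'cV[R]_n) :
    set 'cV[R]_n :=
  [set s | exists u v t, [/\ C u, C v, 0 <= t <= 1 & s = u + t *: (u - v)]].

Definition solver_lipschitz (R : realType) (n p m : nat) (P : program R n p m)
    (L0 : R) (L B : 'I_m -> R) (beta : R) (z : 'cV[R]_m) : R :=
  L0 + beta * spectral_norm ((pA P)^T *m pA P)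
    + \sum_(i < m) (beta * B i * (B i + L i) + L i * `|z i 0|).

(* The requirement of the solver that its smooth term have gradient Lipschitz
   constant solver_lipschitz, at the points where it is not a consequence of
   regularity_constants: search points are extrapolated, and may leave domX P,
   where L0, L and B give no information. Pairs of points of domX P are
   deliberately left out. *)
Definition smooth_at_extrapolated (R : realType) (n p m : nat)
    (P : program R n p m) (L0 : R) (L B : 'I_m -> R) (beta : R)
    (y : 'cV[R]_p) (z : 'cV[R]_m) : Prop :=
  forall u v, (extrapolation_region (domX P) `\` domX P) u ->
    extrapolation_region (domX P) v ->
    enorm (grad (aug_lagrangian_smooth P beta y z) u
           - grad (aug_lagrangian_smooth P beta y z) v) <=
      solver_lipschitz P L0 L B beta z * enorm (u - v).

Definition first_index (Q : nat -> Prop) (j : nat) : Prop :=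
  Q j /\ forall i, (i < j)%N -> ~ Q i.

(* Outer iteration k starts the solver at x k, with inner iterates w k, and
   x k.+1 is the first inner iterate of accuracy eps k. Nothing here presumes
   that such an iterate exists: x k.+1 is unconstrained when there is none. *)
Definition ialm_nesterov_run (R : realType) (n p m : nat)
    (P : program R n p m) (mu L0 : R) (L B : 'I_m -> R) (K : nat)
    (beta rho eps : nat -> R) (x0 : 'cV[R]_n) (y0 : 'cV[R]_p) (z0 : 'cV[R]_m)
    (x : nat -> 'cV[R]_n) (y : nat -> 'cV[R]_p) (z : nat -> 'cV[R]_m)
    (w what : nat -> nat -> 'cV[R]_n) (alpha : nat -> nat -> R) : Prop :=
  [/\ x 0%N = x0, y 0%N = y0, z 0%N = z0 &
      forall k, (k < K)%N ->
        [/\ nesterov_iterates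
              (aug_lagrangian_smooth P (beta k) (y k) (z k))
              (fun u => (ph P u + eindicator (pX P) u)%E)
              (solver_lipschitz P L0 L B (beta k) (z k)) mu
              (x k) (w k) (what k) (alpha k),
            forall j,
              first_index
                (fun i => accurate P (beta k) (y k) (z k) (eps k) (w k i)) j ->
              x k.+1 = w k j,
            y k.+1 = update_y P (rho k) (y k) (x k.+1) &
            z k.+1 = update_z P (rho k) (beta k) (z k) (x k.+1)]].

Definition H_const (R : realType) (n p m : nat) (P : program R n p m)
    (L B : 'I_m -> R) : R :=
  spectral_norm ((pA P)^T *m pA P) + \sum_(i < m) B i * (B i + L i).

Definition Lstar_const (R : realType) (p m : nat) (L0 : R) (L : 'I_m -> R)
    (ystar : 'cV[R]_p) (zstar : 'cV[R]_m) (Ceps : R) : R :=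
  L0 + enorm (\col_i L i)
       * (enorm ystar + 2 * enorm zstar + Num.sqrt Ceps).

(* The logarithmic factor of an iteration count. It is ln r as soon as 1 <= r;
   for r < 1 the negative number ln r could not bound a count. *)
Definition lnp (R : realType) (r : R) : R := Num.max 0 (ln r).

(* Main.v *)
(* With [rho = beta] the iteration is the exact method of multipliers up to the
   inner accuracy. Testing an approximate minimizer against [xstar] and
   completing squares in the multipliers gives, for every dual point
   [(yy, zz)] with [zz >= 0], an inequality that telescopes. Averaging it,
   choosing [yy] and [zz] along the residuals and using the saddle-point
   inequality at [(ystar, zstar)] yields the error bounds; taking
   [(yy, zz) = (ystar, zstar)] instead bounds the multipliers [z k], hence the
   Lipschitz constant of every subproblem by [Lstar + beta * H].

   The minimum of a subproblem need not be attained, so the rates of the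
   accelerated method are proved against an arbitrary feasible point, with all
   distances bounded by the diameter [D]. For [mu = 0] the estimate sequence
   gives the gap [2 L D^2 / (j + 1)^2]. For [mu > 0] put [r = sqrt (mu / L)]:
   the gap is at most [(1 - r)^j L D^2] for [j >= 1], without reference to the
   possibly huge initial value, and it is at most [L D^2 / 4] already after one
   step. Since [exp (- r j)] is at most [exp (- r j / 2) / 2] when
   [exp (- r j / 2) <= 1 / 2], and [1 / 4] is at most the same quantity
   otherwise, one of the steps [1] and [j] is accurate as soon as [j] exceeds
   [(2 / r) * lnp (D^2 (L + mu) / (2 epsk))]. *)

Require Import Defs.
From mathcomp Require Import all_boot all_order all_algebra.
From mathcomp Require Import all_classical all_reals all_analysis.
From mathcomp Require Import ring lra.
Import Order.TTheory GRing.Theory Num.Theory.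
Import numFieldNormedType.Exports.
Local Open Scope classical_set_scope.
Local Open Scope ring_scope.

Set Implicit Arguments.
Unset Strict Implicit.
Unset Printing Implicit Defensive.

(** * Euclidean geometry *)

Section Euclid.
Context {R : realType} {n : nat}.
Implicit Types (u v w : 'cV[R]_n) (c : R).

Lemma dotC u v : dot u v = dot v u.
Proof. by apply: eq_bigr => i _; rewrite mulrC. Qed.

Lemma dotDl u v w : dot (u + v) w = dot u w + dot v w.
Proof. by rewrite -big_split; apply: eq_bigr => i _; rewrite mxE mulrDl. Qed.

Lemma dotZl c u v : dot (c *: u) v = c * dot u v.
Proof. by rewrite mulr_sumr; apply: eq_bigr => i _; rewrite mxE mulrA. Qed.

Lemma dotDr u v w : dot u (v + w) = dot u v + dot u w.
Proof. by rewrite dotC dotDl !(dotC u). Qed.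

Lemma dotZr c u v : dot u (c *: v) = c * dot u v.
Proof. by rewrite dotC dotZl dotC. Qed.

Lemma dotNl u v : dot (- u) v = - dot u v.
Proof. by rewrite -scaleN1r dotZl mulN1r. Qed.

Lemma dotNr u v : dot u (- v) = - dot u v.
Proof. by rewrite dotC dotNl dotC. Qed.

Lemma dot0l u : dot 0 u = 0.
Proof. by rewrite -(scale0r 0) dotZl mul0r. Qed.

Lemma dot0r u : dot u 0 = 0.
Proof. by rewrite dotC dot0l. Qed.

Definition dotE := (dotDl, dotDr, dotNl, dotNr, dotZl, dotZr, dot0l, dot0r).

Lemma dot_suml (I : Type) (r : seq I) (Q : pred I) (F : I -> 'cV[R]_n) v :
  dot (\sum_(i <- r | Q i) F i) v = \sum_(i <- r | Q i) dot (F i) v.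
Proof.
by apply: (big_morph (fun u => dot u v)) => [u w|]; rewrite ?dotDl ?dot0l.
Qed.

Lemma dotuu_ge0 u : 0 <= dot u u.
Proof. by apply: sumr_ge0 => i _; rewrite -expr2 sqr_ge0. Qed.

Lemma dotuu_eq0 u : dot u u = 0 -> u = 0.
Proof.
move/eqP; rewrite psumr_eq0 => [/allP h|i _]; last by rewrite -expr2 sqr_ge0.
apply/colP => i; apply/eqP; rewrite mxE.
by have := h i (mem_index_enum _); rewrite /= mulf_eq0 orbb.
Qed.

Lemma enorm_ge0 u : 0 <= enorm u.
Proof. exact: sqrtr_ge0. Qed.

Lemma sqr_enorm u : enorm u ^+ 2 = dot u u.
Proof. by rewrite sqr_sqrtr // dotuu_ge0. Qed.

Lemma enorm0 : enorm (0 : 'cV[R]_n) = 0.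
Proof. by rewrite /enorm dot0l sqrtr0. Qed.

Lemma enorm_eq0 u : enorm u = 0 -> u = 0.
Proof. by move=> h; apply: dotuu_eq0; rewrite -sqr_enorm h expr0n. Qed.

Lemma enormN u : enorm (- u) = enorm u.
Proof. by rewrite /enorm !dotE opprK. Qed.

Lemma enormB u v : enorm (u - v) = enorm (v - u).
Proof. by rewrite -enormN opprB. Qed.

Lemma enormZ c u : enorm (c *: u) = `|c| * enorm u.
Proof. by rewrite /enorm !dotE mulrA -expr2 sqrtrM ?sqr_ge0// sqrtr_sqr. Qed.

(** Cauchy-Schwarz, from the nonnegative square of [dot v v *: u - dot u v *: v], which equals [dot
    v v * (dot v v * dot u u - dot u v ^+ 2)]. *)
Lemma dot_le_enorm u v : dot u v <= enorm u * enorm v.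
Proof.
have [->|v0] := eqVneq v 0; first by rewrite dot0r enorm0 mulr0.
have vv : 0 < dot v v.
  rewrite lt_def dotuu_ge0 andbT; apply: contraNneq v0 => h.
  by rewrite (dotuu_eq0 h).
have := dotuu_ge0 (dot v v *: u - dot u v *: v).
have -> : dot (dot v v *: u - dot u v *: v) (dot v v *: u - dot u v *: v)
    = dot v v * (dot v v * dot u u - dot u v ^+ 2).
  by rewrite !dotE (dotC v u); ring.
rewrite pmulr_rge0 // subr_ge0 => h.
apply: (le_trans (ler_norm _)).
rewrite -(ler_pXn2r (n := 2)) ?nnegrE ?mulr_ge0 ?enorm_ge0 //.
by rewrite real_normK ?num_real // exprMn !sqr_enorm mulrC.
Qed.

Lemma ler_enormD u v : enorm (u + v) <= enorm u + enorm v.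
Proof.
rewrite -(ler_pXn2r (n := 2)) ?nnegrE ?addr_ge0 ?enorm_ge0 //.
rewrite sqrrD !sqr_enorm !dotE (dotC v u).
have := dot_le_enorm u v; lra.
Qed.

Lemma ler_enorm_sum (I : Type) (r : seq I) (F : I -> 'cV[R]_n) :
  enorm (\sum_(i <- r) F i) <= \sum_(i <- r) enorm (F i).
Proof.
apply: (big_ind2 (fun u c => enorm u <= c)) => [|u a v b hu hv|//].
  by rewrite enorm0.
by rewrite (le_trans (ler_enormD _ _)) // lerD.
Qed.

Lemma ler_coord_enorm u i : `|u i 0| <= enorm u.
Proof.
rewrite -(ler_pXn2r (n := 2)) ?nnegrE ?enorm_ge0 //.
rewrite sqr_enorm real_normK ?num_real // /dot (bigD1 i) //= expr2 lerDl.
by apply: sumr_ge0 => j _; rewrite -expr2 sqr_ge0.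
Qed.

Lemma enorm_le_sum u : enorm u <= \sum_i `|u i 0|.
Proof.
rewrite -(ler_pXn2r (n := 2)) ?nnegrE ?enorm_ge0 //; last exact: sumr_ge0.
rewrite sqr_enorm /dot expr2 mulr_suml ler_sum // => i _.
rewrite -[X in X <= _]ger0_norm -?expr2 ?sqr_ge0 // expr2 normrM.
by rewrite ler_wpM2l // (bigD1 i) //= lerDl sumr_ge0.
Qed.

Lemma dot_delta u k : dot u (delta_mx k 0) = u k 0.
Proof.
rewrite /dot (bigD1 k) //= big1 => [|j hj].
  by rewrite [delta_mx _ _ _ _]mxE !eqxx mulr1 addr0.
by rewrite [delta_mx _ _ _ _]mxE (negPf hj) mulr0.
Qed.

Lemma sqr_enormBZ (t : R) u v :
  enorm (u - t *: v) ^+ 2 =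
    enorm u ^+ 2 + t * (- (2 * dot v u) + t * enorm v ^+ 2).
Proof. by rewrite !sqr_enorm !dotE (dotC v u); ring. Qed.

Lemma sqr_enorm_conv (t : R) u v :
  enorm (t *: u + (1 - t) *: v) ^+ 2 =
    t * enorm u ^+ 2 + (1 - t) * enorm v ^+ 2
    - t * (1 - t) * enorm (u - v) ^+ 2.
Proof. by rewrite !sqr_enorm !dotE (dotC v u); ring. Qed.

End Euclid.

Lemma dot_trmx (R : realType) (p n : nat) (M : 'M[R]_(p, n)) y x :
  dot (M^T *m y) x = dot y (M *m x).
Proof.
have dotmx k (u v : 'cV[R]_k) : dot u v = (u^T *m v) 0 0.
  by rewrite mxE; apply: eq_bigr => i _; rewrite mxE.
by rewrite !dotmx trmx_mul trmxK mulmxA.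
Qed.

(** A crude entrywise bound. It shows that the set whose [sup] is [spectral_norm] is bounded above,
    without which that [sup] would carry no information. *)
Lemma enorm_mulmx_bounded (R : realType) (p n : nat) (M : 'M[R]_(p, n)) :
  exists2 c, 0 <= c & forall v, enorm (M *m v) <= c * enorm v.
Proof.
exists (\sum_i \sum_j `|M i j|) => [|v].
  by apply: sumr_ge0 => i _; apply: sumr_ge0.
apply: (le_trans (enorm_le_sum _)); rewrite mulr_suml ler_sum // => i _.
rewrite mxE mulr_suml (le_trans (ler_norm_sum _ _ _)) // ler_sum // => j _.
by rewrite normrM ler_wpM2l // ler_coord_enorm.
Qed.

Lemma enorm_mulmx_le (R : realType) (p n : nat) (M : 'M[R]_(p, n)) v :
  enorm (M *m v) <= spectral_norm M * enorm v.
Proof.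
have [c c0 hc] := enorm_mulmx_bounded M.
have [->|v0] := eqVneq v 0; first by rewrite mulmx0 !enorm0 mulr0.
have nv : 0 < enorm v.
  by rewrite lt_def enorm_ge0 andbT; apply: contraNneq v0 => /enorm_eq0 ->.
rewrite -ler_pdivrMr //; apply: ub_le_sup.
  exists c => _ [u hu <-]; apply: (le_trans (hc u)).
  by rewrite -[leRHS]mulr1 ler_wpM2l.
exists ((enorm v)^-1 *: v) => /=.
  by rewrite enormZ ger0_norm ?invr_ge0 ?enorm_ge0 // mulVf // gt_eqF.
by rewrite -scalemxAr enormZ ger0_norm ?invr_ge0 ?enorm_ge0 // mulrC.
Qed.

Lemma spectral_norm_ge0 (R : realType) (p n : nat) (M : 'M[R]_(p, n)) :
  0 <= spectral_norm M.
Proof.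
have [c c0 hc] := enorm_mulmx_bounded M.
apply: ub_le_sup; last by exists 0; rewrite /= ?mulmx0 enorm0.
exists c => _ [u hu <-]; apply: (le_trans (hc u)).
by rewrite -[leRHS]mulr1 ler_wpM2l.
Qed.

(** [bounded_set] refers to the max norm. It bounds each coordinate, hence Euclidean distances, so
    the [sup] in [diam] is a genuine upper bound. *)
Lemma le_diam (R : realType) (n : nat) (C : set 'cV[R]_n) u v :
  bounded_set C -> C u -> C v -> enorm (u - v) <= diam C.
Proof.
move=> [M [_ /(_ (`|M| + 1))]] hM Cu Cv.
have {}hM : forall x, C x -> `|x| <= `|M| + 1.
  by apply: hM; rewrite (le_lt_trans (ler_norm _)) // ltrDl.
apply: ub_le_sup; last by exists u, v.
exists (\sum_(i < n) 2 * (`|M| + 1)) => _ [x [y [Cx Cy ->]]].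
apply: (le_trans (enorm_le_sum _)); apply: ler_sum => i _.
have hc z : C z -> `|z i 0| <= `|M| + 1.
  move=> Cz; apply: le_trans (hM z Cz).
  by rewrite [leRHS]mx_normrE; exact: (le_bigmax _ (fun k => `|z k.1 k.2|) (i, 0)).
rewrite !mxE (le_trans (ler_normB _ _)) //.
by have := hc x Cx; have := hc y Cy; lra.
Qed.

(** Letting [t] tend to 0. This and its variant along [t = 1 / N] replace explicit limits in the
    convexity arguments below. *)
Lemma ler_addlim (R : realType) (a b c : R) :
  (forall t, 0 < t <= 1 -> a <= b + t * c) -> a <= b.
Proof.
move=> h; apply/ler_addgt0Pr => e e0.
pose t := Num.min 1 (e / (`|c| + 1)).
have c1 : 0 < `|c| + 1 by rewrite ltr_wpDl.
have t0 : 0 < t by rewrite lt_min ltr01 divr_gt0.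
have t1 : t <= 1 by rewrite ge_min lexx.
apply: (le_trans (h t _)); first by rewrite t0 t1.
rewrite lerD2l; apply: (@le_trans _ _ (t * (`|c| + 1))).
  by rewrite ler_wpM2l ?(ltW t0) //; have := ler_norm c; lra.
by rewrite -ler_pdivlMr // ge_min lexx orbT.
Qed.

Lemma ler_addlim_nat (R : realType) (a b c : R) :
  (forall N : nat, (0 < N)%N -> a <= b + N%:R^-1 * c) -> a <= b.
Proof.
move=> h; apply: (@ler_addlim _ _ _ `|c|) => t /andP[t0 t1].
have [N hN] : exists N : nat, t^-1 <= N%:R.
  exists (Num.truncn t^-1).+1; apply: ltW; apply: truncnS_gt.
have N0 : (0 < N)%N by rewrite -(ltr_nat R) (lt_le_trans _ hN) // invr_gt0.
apply: (le_trans (h N N0)); rewrite lerD2l.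
apply: (@le_trans _ _ (N%:R^-1 * `|c|)).
  by rewrite ler_wpM2l ?ler_norm // invr_ge0.
by rewrite ler_wpM2r // -[leRHS]invrK lef_pV2 // posrE ?invr_gt0 // ltr0n.
Qed.

(** * Gradients *)

(** The differential is linear, so expanding [v] in the standard basis brings out the partial
    derivatives. *)
Lemma dot_grad (R : realType) (n : nat) (F : 'cV[R]_n -> R) x v :
  differentiable F x -> dot (grad F x) v = 'D_v F x.
Proof.
move=> dF; rewrite deriveE //.
rewrite [in RHS](matrix_sum_delta v) linear_sum; apply: eq_bigr => i _.
rewrite big_ord1 linearZ /= mxE deriveE // mulrC.
by rewrite (_ : ord0 = 0).
Qed.

Lemma strongly_convex_grad_le (R : realType) (n : nat) (mu : R)
    (F : 'cV[R]_n -> R) p u :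
  strongly_convex mu F -> differentiable F p ->
  F p + dot (grad F p) (u - p) + mu / 2 * enorm (u - p) ^+ 2 <= F u.
Proof.
move=> cF dF; rewrite dot_grad //.
set q := mu / 2 * _.
suff : 'D_(u - p) F p <= F u - F p - q by lra.
(* By strong convexity the difference quotient at step [h] is at most [F u - F p - q + h * q]. For
   [h <= t] the last term is absorbed by [t * |q|], and [t] is arbitrary. *)
apply: (@ler_addlim _ _ _ `|q|) => t /andP[t0 t1].
have dFp : derivable F p (u - p) by exact: diff_derivable.
have cv : (fun h => h^-1 *: ((F \o shift p) (h *: (u - p)) - F p)) @ (0:R)^'+
    --> 'D_(u - p) F p by apply: cvg_dnbhs_at_right.
rewrite -(cvg_lim _ cv) //; apply: limr_le; first exact: (cvgP _ cv).
near=> h.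
have h0 : 0 < h by [].
have ht : h <= t by near: h; apply: nbhs_right_le.
have h1 : h <= 1 by exact: le_trans ht t1.
rewrite /= [_ *: _]mulrC ler_pdivrMr //.
have -> : h *: (u - p) + p = h *: u + (1 - h) *: p.
  by apply/colP => i; rewrite !mxE; ring.
have := cF u p h; rewrite (ltW h0) h1 => /(_ isT) hF.
have hq : - (h * q) <= h * `|q| by rewrite -mulrN ler_wpM2l ?(ltW h0) // -normrN ler_norm.
have hh : h * (h * q) <= h * (t * `|q|).
  rewrite ler_wpM2l ?(ltW h0) //; apply: (@le_trans _ _ (h * `|q|)).
    by rewrite ler_wpM2l ?(ltW h0) // ler_norm.
  by rewrite ler_wpM2r.
have : mu / 2 * (h * (1 - h)) * enorm (u - p) ^+ 2 = h * q - h * (h * q) by rewrite /q; ring.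
nra.
Unshelve. all: by end_near.
Qed.

(** A quadratic remainder determines the derivative. This handles the penalty terms, including
    [psi_beta], whose two branches would otherwise have to be glued. *)
Lemma is_derive_quad (R : realType) (V : normedModType R) (F : V -> R) x v c M :
  (forall h : R, `|F (h *: v + x) - F x - h * c| <= M * h ^+ 2) ->
  is_derive x v F c.
Proof.
move=> hF.
have cv : (fun h => h^-1 *: ((F \o shift x) (h *: v) - F x)) @ (0:R)^' --> c.
  apply/cvgrPdist_le => e e0; near=> h.
  have h0 : h != 0 by near: h; exact: nbhs_dnbhs_neq.
  have hM : (`|M| + 1) * `|h| <= e.
    rewrite mulrC -ler_pdivlMr ?ltr_wpDl //.
    by near: h; apply: dnbhs0_le; rewrite divr_gt0 // ltr_wpDl.
  rewrite /= -[_ *: _]/(h^-1 * _).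
  have -> : c - h^-1 * (F (h *: v + x) - F x) =
      - (h^-1 * (F (h *: v + x) - F x - h * c)) by field.
  rewrite normrN normrM normfV ler_pdivrMl ?normr_gt0 //.
  apply: (le_trans (hF h)); rewrite -(real_normK (num_real h)).
  apply: (@le_trans _ _ (`|h| * ((`|M| + 1) * `|h|))).
    have := ler_norm M; have := normr_ge0 h; have := normr_ge0 M; nra.
  by rewrite ler_wpM2l.
split; first exact: (cvgP _ cv).
exact: cvg_lim cv.
Unshelve. all: by end_near.
Qed.

Lemma is_derive_comp_dir (R : realType) (n : nat) (f : 'cV[R]_n -> R)
    (k : R -> R) x v c :
  differentiable f x -> is_derive (f x) 1 k c ->
  is_derive x v (k \o f) (c * dot (grad f x) v).
Proof.
move=> df dk; have dk' : differentiable k (f x) by apply/derivable1_diffP.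
have dkf : differentiable (k \o f) x by exact: differentiable_comp.
split; first exact: diff_derivable.
rewrite deriveE // diff_comp //= dot_grad // (deriveE _ df).
transitivity ('d f x v * 'd k (f x) 1).
  by rewrite -[in LHS](mulr1 ('d f x v)); exact: linearZ.
by have [_ <-] := dk; rewrite (deriveE _ dk') mulrC.
Qed.

(** Completing the square merges the two branches into one squared positive part. The same formula
    later makes the penalty a difference of squared multipliers. *)
Lemma psi_betaE (R : realType) (beta u v : R) : 0 < beta ->
  psi_beta beta u v = (Num.max 0 (v + beta * u) ^+ 2 - v ^+ 2) / (2 * beta).
Proof.
move=> b0; rewrite /psi_beta addrC; case: leP => hs; first by field; lra.
by field; lra.
Qed.

(** The remainder of the squared positive part over an increment [k] lies between 0 and [k ^+ 2], as
    a check of the signs of [a] and [a + k] shows. *)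
Lemma is_derive_psi_beta (R : realType) (beta u v : R) : 0 < beta ->
  is_derive u 1 ((psi_beta beta)^~ v) (Num.max 0 (v + beta * u)).
Proof.
move=> b0; have b2 : 0 < 2 * beta by lra.
apply: (@is_derive_quad _ _ _ _ _ _ (beta / 2)) => h.
rewrite !psi_betaE //; set s := h *: 1 + u.
have -> : s = u + h by rewrite /s [h *: 1]mulr1 addrC.
set a := v + beta * u; have -> : v + beta * (u + h) = a + beta * h by rewrite /a; ring.
have -> : (Num.max 0 (a + beta * h) ^+ 2 - v ^+ 2) / (2 * beta)
    - (Num.max 0 a ^+ 2 - v ^+ 2) / (2 * beta) - h * Num.max 0 a
  = (Num.max 0 (a + beta * h) ^+ 2 - Num.max 0 a ^+ 2 - 2 * (beta * h) * Num.max 0 a)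
     / (2 * beta) by field; lra.
rewrite normrM normfV (gtr0_norm b2) ler_pdivrMr //.
have -> : beta / 2 * h ^+ 2 * (2 * beta) = (beta * h) ^+ 2 by field.
rewrite ler_norml; set k := beta * h.
by case: (leP 0 a) => ha; case: (leP 0 (a + k)) => hak; apply/andP; split; nra.
Qed.

(** * Smooth convex functions *)

Definition segment_closed (R : realType) (n : nat) (C : set 'cV[R]_n) :=
  forall u v t, C u -> C v -> 0 <= t <= 1 -> C (t *: u + (1 - t) *: v).

Definition convex_on (R : realType) (n : nat) (C : set 'cV[R]_n)
    (F : 'cV[R]_n -> R) :=
  forall u v t, C u -> C v -> 0 <= t <= 1 ->
    F (t *: u + (1 - t) *: v) <= t * F u + (1 - t) * F v.

(** First-order form of strong convexity. It is required at all points of the space, because search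
    points may leave the set on which [G] is known to be Lipschitz. *)
Definition gradient_ineq (R : realType) (n : nat) (mu : R)
    (F : 'cV[R]_n -> R) (G : 'cV[R]_n -> 'cV[R]_n) :=
  forall p u, F p + dot (G p) (u - p) + mu / 2 * enorm (u - p) ^+ 2 <= F u.

Section Smoothness.
Context {R : realType} {n : nat} {phi : 'cV[R]_n -> R}
  {G : 'cV[R]_n -> 'cV[R]_n}.

Lemma gradient_ineq_le (mu nu : R) :
  nu <= mu -> gradient_ineq mu phi G -> gradient_ineq nu phi G.
Proof.
move=> h hG p u; apply: le_trans (hG p u); rewrite lerD2l.
by rewrite ler_wpM2r ?sqr_ge0 // ler_pM2r.
Qed.

(** Average the two tangent inequalities at the intermediate point [p]: their linear terms
    cancel. *)
Lemma gradient_ineq_conv (mu : R) u v t :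
  gradient_ineq mu phi G -> 0 <= t <= 1 ->
  phi (t *: u + (1 - t) *: v) <=
    t * phi u + (1 - t) * phi v - mu / 2 * (t * (1 - t)) * enorm (u - v) ^+ 2.
Proof.
move=> hG /andP[t0 t1]; set p := t *: u + (1 - t) *: v.
have := hG p u; have := hG p v.
have -> : u - p = (1 - t) *: (u - v) by apply/colP => i; rewrite !mxE; ring.
have -> : v - p = - t *: (u - v) by apply/colP => i; rewrite !mxE; ring.
rewrite !sqr_enorm !(dotZl, dotZr); move: (dot (u - v) _) (dot (G p) _) => D d.
move=> hv hu; have s0 : 0 <= 1 - t by lra.
have := ler_wpM2l t0 hu; have := ler_wpM2l s0 hv; lra.
Qed.

(** A Riemann sum in place of an integral. The segment is cut into [N] pieces and the tangent
    inequality is used at the far end of each; the total [L / 2 * (1 + 1 / N)] times the squared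
    length tends to the claimed term. The Lipschitz bound enters only between [p] and points of the
    segment. *)
Lemma descent_lemma (L : R) p e : gradient_ineq 0 phi G ->
  (forall s, 0 <= s <= 1 -> enorm (G (p + s *: e) - G p) <= L * (s * enorm e)) ->
  phi (p + e) <= phi p + dot (G p) e + L / 2 * enorm e ^+ 2.
Proof.
move=> hG hL; apply: (@ler_addlim_nat _ _ _ (L / 2 * enorm e ^+ 2)) => N N0.
have N0' : 0 < N%:R :> R by rewrite ltr0n.
suff key k : (k <= N)%N -> phi (p + (k%:R / N%:R) *: e) <=
    phi p + (k%:R / N%:R) * dot (G p) e
      + L * enorm e ^+ 2 * (k%:R * (k%:R + 1)) / (2 * N%:R ^+ 2).
  have := key N (leqnn N); rewrite divff ?gt_eqF // scale1r => /le_trans; apply.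
  by rewrite le_eqVlt; apply/orP; left; apply/eqP; field; lra.
elim: k => [_|k IH hk]; first by rewrite mul0r scale0r addr0; lra.
have {}IH := IH (ltnW hk).
set s := k.+1%:R / N%:R.
have s01 : 0 <= s <= 1.
  by rewrite divr_ge0 ?ler0n //= ler_pdivrMr // mul1r ler_nat.
have sE : s = k%:R / N%:R + N%:R^-1 by rewrite /s -natr1; field; lra.
have h1 := hG (p + s *: e) (p + (k%:R / N%:R) *: e).
have dE : p + (k%:R / N%:R) *: e - (p + s *: e) = - N%:R^-1 *: e.
  by rewrite sE; apply/colP => i; rewrite !mxE; ring.
rewrite dE !mul0r addr0 dotZr in h1.
have h2 : dot (G (p + s *: e)) e <= dot (G p) e + L * (s * enorm e) * enorm e.
  have -> : dot (G (p + s *: e)) e = dot (G p) e + dot (G (p + s *: e) - G p) e.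
    by rewrite !dotE; ring.
  rewrite lerD2l (le_trans (dot_le_enorm _ _)) // ler_wpM2r ?enorm_ge0 //.
  exact: hL.
have Ni : 0 <= N%:R^-1 :> R by rewrite invr_ge0 ler0n.
have := ler_wpM2l Ni h2 => h3.
apply: (@le_trans _ _ (phi (p + (k%:R / N%:R) *: e)
   + N%:R^-1 * (dot (G p) e + L * (s * enorm e) * enorm e))); first lra.
apply: (le_trans (lerD IH (lexx _))).
rewrite /s -natr1 le_eqVlt; apply/orP; left; apply/eqP; field; lra.
Qed.

Context {C : set 'cV[R]_n} {L : R}.
Hypothesis cC : segment_closed C.

Lemma segment_closed3 u v x a b c : C u -> C v -> C x ->
  0 <= a -> 0 <= b -> 0 <= c -> a + b + c = 1 ->
  C (a *: u + b *: v + c *: x).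
Proof using cC.
move=> Cu Cv Cx a0 b0 c0 abc.
have [c1|c1] := eqVneq c 1.
  have [-> ->] : a = 0 /\ b = 0 by split; lra.
  by rewrite c1 !scale0r !add0r scale1r.
have c1' : c < 1 by rewrite lt_def eq_sym c1 /=; lra.
have s0 : 0 < 1 - c by lra.
have -> : a *: u + b *: v + c *: x =
  c *: x + (1 - c) *: ((a / (1 - c)) *: u + (1 - a / (1 - c)) *: v).
  have -> : b = 1 - c - a by lra.
  by apply/colP => i; rewrite !mxE; field; lra.
apply: cC => //; last lra.
apply: cC => //; rewrite divr_ge0 ?(ltW s0) //= ler_pdivrMr //; lra.
Qed.

Hypothesis hG : gradient_ineq 0 phi G.
Hypothesis hL : elipschitz_on L C G.

Lemma descent_on p u : C p -> C u ->
  phi u <= phi p + dot (G p) (u - p) + L / 2 * enorm (u - p) ^+ 2.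
Proof using cC hG hL.
move=> Cp Cu; have -> : phi u = phi (p + (u - p)) by rewrite addrC subrK.
apply: descent_lemma => // s s01.
apply: le_trans (hL _ Cp) _.
  by have := cC Cu Cp s01; congr C; apply/colP => i; rewrite !mxE; ring.
by rewrite addrC addKr enormZ ger0_norm //; case/andP: s01.
Qed.

(** The diagonals of a parallelogram share their midpoint [m]. The descent bound on one diagonal and
    the tangent inequality on the other have gradient terms at [m] that cancel in pairs. *)
Lemma mixed_difference_ge p h k : C p -> C (p + h) -> C (p + k) ->
  C (p + h + k) ->
  - (L / 4 * enorm (h - k) ^+ 2) <=
    phi (p + h + k) - phi (p + h) - (phi (p + k) - phi p).
Proof using cC hG hL.
move=> Cp Ch Ck Chk.
pose m := 2^-1 *: (p + h) + (1 - 2^-1) *: (p + k).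
have Cm : C m by apply: cC => //; lra.
have := descent_on Cm Ch; have := descent_on Cm Ck.
have := hG m p; have := hG m (p + h + k).
have -> : p + h - m = 2^-1 *: (h - k) by apply/colP => i; rewrite !mxE; field.
have -> : p + k - m = - 2^-1 *: (h - k) by apply/colP => i; rewrite !mxE; field.
have -> : p + h + k - m = 2^-1 *: (h + k) by apply/colP => i; rewrite !mxE; field.
have -> : p - m = - 2^-1 *: (h + k) by apply/colP => i; rewrite !mxE; field.
by rewrite !sqr_enorm !dotE (dotC k h); lra.
Qed.

(* A cocoercivity inequality that only uses the Lipschitz bound inside [C]:
   thin parallelograms along the segment from [v] to [u], with sides
   proportional to [u - v] and [x - u], stay inside the triangle [u v x]. *)
Lemma cocoercive_on u v x : 0 <= L -> C u -> C v -> C x ->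
  dot (G u - G v) (u - x) <= L / 4 * enorm ((u - v) + (u - x)) ^+ 2.
Proof using cC hG hL.
move=> L0 Cu Cv Cx.
pose d := u - v; pose e := x - u.
(* The errors of order [1 / N]: replacing [(1 - i) *: d - e] by [d - e], the quadratic term of the
   descent bound at [u], and the change of gradient from [v'] to [v]. *)
pose c := L / 4 * (2 * `|dot d (d - e)| + enorm d ^+ 2)
  + L / 2 * enorm e ^+ 2 + L * (enorm d * enorm e).
apply: (@ler_addlim_nat _ _ _ c) => N N0.
have N0' : 0 < N%:R :> R by rewrite ltr0n.
have N1 : 1 <= N%:R :> R by rewrite ler1n.
pose i := N%:R^-1 : R.
have i0 : 0 < i by rewrite invr_gt0.
have i1 : i <= 1 by rewrite /i invf_le1.
have iN : i * N%:R = 1 by rewrite /i mulVf // gt_eqF.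
(* Starting at [v'] gives [u] a weight of at least [i], which pays for the shift [i *: e] towards
   [x]. The steps [i * (1 - i)] are shortened so that [N] of them end exactly at [u]. *)
pose v' := v + i *: d.
pose q (s : R) := v' + (s * i * (1 - i)) *: d.
have Cq (k : nat) (t : R) : (k <= N)%N -> 0 <= t <= 1 ->
    C (q k%:R + (t * i) *: e).
  move=> hk /andP[t0 t1].
  have kN : k%:R <= N%:R :> R by rewrite ler_nat.
  have k0 : 0 <= k%:R :> R by rewrite ler0n.
  have ki : k%:R * i <= 1 by have := ler_wpM2r (ltW i0) kN; lra.
  have := @segment_closed3 u v x (i + k%:R * i * (1 - i) - t * i)
    (1 - i - k%:R * i * (1 - i)) (t * i) Cu Cv Cx.
  have -> : (i + k%:R * i * (1 - i) - t * i) *: u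
     + (1 - i - k%:R * i * (1 - i)) *: v + (t * i) *: x
     = q k%:R + (t * i) *: e.
    by apply/colP => l; rewrite /q /v' /d /e !mxE; ring.
  apply.
  - have : 0 <= k%:R * i * (1 - i) by rewrite !mulr_ge0 ?(ltW i0) //; lra.
    have : 0 <= (1 - t) * i by rewrite mulr_ge0 ?(ltW i0) //; lra.
    lra.
  - have -> : 1 - i - k%:R * i * (1 - i) = (1 - i) * (1 - k%:R * i) by ring.
    by rewrite mulr_ge0 //; lra.
  - by rewrite mulr_ge0 // ltW.
  - by ring.
have Cq0 (k : nat) : (k <= N)%N -> C (q k%:R).
  by move=> hk; have := Cq k 0 hk; rewrite mul0r scale0r addr0; apply; lra.
have Cq1 (k : nat) : (k <= N)%N -> C (q k%:R + i *: e).
  by move=> hk; have := Cq k 1 hk; rewrite mul1r; apply; lra.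
pose h := (i * (1 - i)) *: d.
have qS (k : nat) : q k.+1%:R = q k%:R + h.
  by rewrite /q /h -natr1; apply/colP => l; rewrite !mxE; ring.
have sum k : (k <= N)%N -> - (k%:R * (L / 4 * enorm (h - i *: e) ^+ 2)) <=
    phi (q k%:R + i *: e) - phi (q k%:R)
    - (phi (q 0%:R + i *: e) - phi (q 0%:R)).
  elim: k => [_|k IH hk]; first by rewrite mul0r oppr0 subrr.
  have {}IH := IH (ltnW hk).
  have := @mixed_difference_ge (q k%:R) h (i *: e).
  rewrite -qS => /(_ (Cq0 _ (ltnW hk)) (Cq0 _ hk) (Cq1 _ (ltnW hk)) (Cq1 _ hk)).
  set X := L / 4 * _ in IH *.
  have -> : k.+1%:R * X = k%:R * X + X by rewrite -natr1 mulrDl mul1r.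
  lra.
have {sum} := sum N (leqnn N).
have -> : q N%:R = u.
  rewrite /q [N%:R * i]mulrC iN mul1r /v' /d.
  by apply/colP => l; rewrite !mxE; ring.
have q0 : q 0%:R = v' by rewrite /q !mul0r scale0r addr0.
have Cv' : C v' by rewrite -q0; apply: Cq0.
have Cu1 : C (u + i *: e).
  have := cC Cx Cu; move=> /(_ i); rewrite (ltW i0) i1 => /(_ isT).
  by congr C; apply/colP => l; rewrite /e !mxE; ring.
rewrite q0 => hsum.
(* The mixed differences have telescoped to increments of [phi] along [i *: e] at [u] and at [v'].
   The first is bounded above by descent, the second below by the tangent; division by [i] then
   leaves gradients. *)
have h1 := descent_on Cu Cu1.
have h2 := hG v' (v' + i *: e).
rewrite !(addrC _ (i *: e)) !addrK !mul0r addr0 in h1 h2.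
rewrite !(addrC _ (i *: e)) in hsum.
have E1 : h - i *: e = i *: ((1 - i) *: d - e).
  by apply/colP => l; rewrite !mxE; ring.
rewrite E1 in hsum.
have E2 : N%:R * (L / 4 * enorm (i *: ((1 - i) *: d - e)) ^+ 2)
   = i * (L / 4 * enorm ((1 - i) *: d - e) ^+ 2).
  by rewrite enormZ (gtr0_norm i0) -[RHS]mul1r -[X in _ = X * _]iN; ring.
rewrite E2 in hsum.
have E3 : enorm ((1 - i) *: d - e) ^+ 2 <=
    enorm (d - e) ^+ 2 + i * (2 * `|dot d (d - e)| + enorm d ^+ 2).
  have -> : (1 - i) *: d - e = (d - e) - i *: d.
    by apply/colP => l; rewrite !mxE; ring.
  have -> : enorm (d - e - i *: d) ^+ 2
    = enorm (d - e) ^+ 2 + i * (- (2 * dot d (d - e)) + i * enorm d ^+ 2).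
    exact: sqr_enormBZ.
  rewrite lerD2l ler_pM2l // lerD //.
    by rewrite -mulrN ler_wpM2l // -normrN ler_norm.
  by rewrite -[leRHS]mul1r ler_wpM2r // sqr_ge0.
have -> : (u - v) + (u - x) = d - e by rewrite /e opprB.
have -> : dot (G u - G v) (u - x) = dot (G v' - G u) e + - dot (G v' - G v) e.
  by rewrite /e !dotE; ring.
have h4 : i * dot (G v' - G u) e <=
   i * (L / 4 * enorm ((1 - i) *: d - e) ^+ 2 + i * (L / 2 * enorm e ^+ 2)).
  rewrite enormZ (gtr0_norm i0) in h1.
  rewrite dotDl dotNl; rewrite !dotZr in h1 h2; lra.
rewrite ler_pM2l // in h4.
have h5 : - dot (G v' - G v) e <= i * (L * (enorm d * enorm e)).
  rewrite -dotNl; apply: (le_trans (dot_le_enorm _ _)).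
  rewrite enormN; have := hL Cv' Cv.
  rewrite /v' addrAC subrr add0r enormZ (gtr0_norm i0) => hh.
  have := ler_wpM2r (enorm_ge0 e) hh; lra.
have L4 : 0 <= L / 4 by lra.
have := ler_wpM2l L4 E3; rewrite /c -/i; lra.
Qed.

End Smoothness.

(** * Rates of the accelerated method *)

(** All that the rate proofs use about a step. The term [- mu] comes from strong convexity of the
    smooth part, the last term from that of the proximal model. *)
Definition prox_step (R : realType) (n : nat) (C : set 'cV[R]_n)
    (F : 'cV[R]_n -> R) (L mu : R) (what w : 'cV[R]_n) :=
  forall u, C u ->
    F w <= F u + (L - mu) / 2 * enorm (u - what) ^+ 2
         - L / 2 * enorm (u - w) ^+ 2.

Section Prox.
Context {R : realType} {n : nat} {C : set 'cV[R]_n} {h : 'cV[R]_n -> R}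
  {L : R}.
Hypothesis cC : segment_closed C.
Hypothesis ch : convex_on C h.

(** The model is strongly convex with modulus [L]: compare [w] with [t *: u + (1 - t) *: w], divide
    by [t] and let [t] tend to 0. *)
Lemma prox_three_point g what w u : C w -> C u ->
  (forall v, C v -> dot g w + L / 2 * enorm (w - what) ^+ 2 + h w <=
                    dot g v + L / 2 * enorm (v - what) ^+ 2 + h v) ->
  dot g w + L / 2 * enorm (w - what) ^+ 2 + h w + L / 2 * enorm (u - w) ^+ 2 <=
    dot g u + L / 2 * enorm (u - what) ^+ 2 + h u.
Proof using cC ch.
move=> Cw Cu hw.
apply: (@ler_addlim _ _ _ (L / 2 * enorm (u - w) ^+ 2)) => t /andP[t0 t1].
have t01 : 0 <= t <= 1 by rewrite (ltW t0).
have := hw _ (cC Cu Cw t01); have := ch Cu Cw t01.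
have -> : t *: u + (1 - t) *: w - what =
    t *: (u - what) + (1 - t) *: (w - what).
  by apply/colP => i; rewrite !mxE; ring.
rewrite sqr_enorm_conv.
have -> : u - what - (w - what) = u - w by apply/colP => i; rewrite !mxE; ring.
rewrite dotDr !dotZr.
move: (enorm (u - what) ^+ 2) (enorm (w - what) ^+ 2) (enorm (u - w) ^+ 2).
move=> U W D h1 h2.
rewrite -(ler_pM2l t0); lra.
Qed.

Lemma prox_stepP (phi : 'cV[R]_n -> R) (mu : R) G what w :
  gradient_ineq mu phi G -> C w ->
  phi w <= phi what + dot (G what) (w - what) + L / 2 * enorm (w - what) ^+ 2 ->
  (forall v, C v ->
     dot (G what) w + L / 2 * enorm (w - what) ^+ 2 + h w <=
     dot (G what) v + L / 2 * enorm (v - what) ^+ 2 + h v) ->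
  prox_step C (fun x => phi x + h x) L mu what w.
Proof using cC ch.
move=> hG Cw hd hw u Cu; have := prox_three_point Cw Cu hw.
by have := hG what u; move: hd; rewrite !dotDr !dotNr; lra.
Qed.

(* Half of the classical bound [L |x - w0|^2 / 2]: without this factor the
   count of a strongly convex run of a few steps would not be met. *)
Lemma prox_first_step (phi : 'cV[R]_n -> R) G w0 w x : 0 <= L ->
  gradient_ineq 0 phi G -> elipschitz_on L C G -> C w0 -> C w -> C x ->
  (forall v, C v ->
     dot (G w0) w + L / 2 * enorm (w - w0) ^+ 2 + h w <=
     dot (G w0) v + L / 2 * enorm (v - w0) ^+ 2 + h v) ->
  phi w + h w <= phi x + h x + L / 4 * enorm (w0 - x) ^+ 2.
Proof using cC ch.
move=> L0 hG hL Cw0 Cw Cx hw.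
(* The tangent is taken at [w], not at [w0]. The discrepancy [dot (G w - G w0) (w - x)] is bounded
   by cocoercivity, and with the three-point terms it collapses to [L / 4] times the squared
   distance of [w0] and [x]. *)
have := prox_three_point Cw Cx hw; have := hG w x.
have := cocoercive_on cC hG hL L0 Cw Cw0 Cx.
rewrite !sqr_enorm !dotE (dotC w0 w) (dotC x w) (dotC w0 x); lra.
Qed.

End Prox.

(** * Potential functions for the accelerated iteration *)

Section Rates.
Context {R : realType} {n : nat} {C : set 'cV[R]_n} {F : 'cV[R]_n -> R}
  {L mu : R}.
Variables (w what : nat -> 'cV[R]_n) (x : 'cV[R]_n).
Hypothesis cC : segment_closed C.
Hypothesis Cw : forall j, C (w j).
Hypothesis Cx : C x.
Hypothesis what0 : what 0%N = w 0%N.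
Hypothesis hprox : forall j, prox_step C F L mu (what j) (w j.+1).

(** The prox step is tested at [alpha i.+1 *: x + (1 - alpha i.+1) *: w i.+1]. The extrapolation
    rule makes its distances to [what i.+1] and [w i.+2] equal to [alpha i.+1] times the norms of
    [V i] and [V i.+1], so the potential divided by [alpha i ^+ 2] does not increase. *)
Lemma fista_rate (alpha : nat -> R) (j : nat) : mu = 0 -> 0 <= L ->
  convex_on C F -> alpha 0%N = 1 ->
  (forall i, 0 < alpha i <= 1) ->
  (forall i, alpha i.+1 ^+ 2 = (1 - alpha i.+1) * alpha i ^+ 2) ->
  (forall i, what i.+1 = w i.+1 +
     (alpha i.+1 * (1 - alpha i) / alpha i) *: (w i.+1 - w i)) ->
  F (w j.+1) - F x <= alpha j ^+ 2 * (L / 2 * enorm (w 0%N - x) ^+ 2).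
Proof using All.
move=> mu0 L0 cF a0 a01 aS hatS.
(* [V i] is the auxiliary point of the estimate sequence, relative to [x]. *)
pose V i := (w i.+1 - x) + (((alpha i)^-1 - 1) *: (w i.+1 - w i)).
suff key i : F (w i.+1) - F x + alpha i ^+ 2 * (L / 2 * enorm (V i) ^+ 2)
    <= alpha i ^+ 2 * (L / 2 * enorm (w 0%N - x) ^+ 2).
  apply: le_trans (key j); rewrite lerDl.
  by apply: mulr_ge0 (sqr_ge0 _) (mulr_ge0 _ (sqr_ge0 _)); lra.
elim: i => [|i IH].
  have := hprox 0 Cx; rewrite what0 /V a0 invr1 subrr scale0r addr0.
  by rewrite mu0 (enormB x (w 0%N)) (enormB x (w 1%N)); lra.
have /andP[p0 p1] := a01 i; have /andP[q0 q1] := a01 i.+1.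
have q01 : 0 <= alpha i.+1 <= 1 by rewrite (ltW q0).
have := hprox i.+1 (cC Cx (Cw i.+1) q01).
have := cF _ _ _ Cx (Cw i.+1) q01.
set u := _ *: x + _ *: w i.+1.
have -> : u - what i.+1 = - (alpha i.+1 *: V i).
  rewrite hatS /u /V; apply/colP => k; rewrite !mxE; field; lra.
have -> : u - w i.+2 = - (alpha i.+1 *: V i.+1).
  by rewrite /u /V; apply/colP => k; rewrite !mxE; field; lra.
rewrite !enormN !enormZ !(gtr0_norm q0) !exprMn mu0 subr0 => hF hp.
have : alpha i.+1 ^+ 2 = (1 - alpha i.+1) * alpha i ^+ 2 by exact: aS.
have s0 : 0 <= 1 - alpha i.+1 by lra.
have := ler_wpM2l s0 IH.
move: (enorm (V i) ^+ 2) (enorm (V i.+1) ^+ 2) (enorm (w 0%N - x) ^+ 2) hp.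
move=> U W D hp h1 h2.
have e1 : (1 - alpha i.+1) * (alpha i ^+ 2 * (L / 2 * U)) =
  alpha i.+1 ^+ 2 * (L / 2 * U) by rewrite h2; ring.
have e2 : (1 - alpha i.+1) * (alpha i ^+ 2 * (L / 2 * D)) =
  alpha i.+1 ^+ 2 * (L / 2 * D) by rewrite h2; ring.
move: e1 e2; lra.
Qed.

(** The potential [F (w i.+1) - F x + L / 2 * enorm (p i) ^+ 2] contracts by [1 - r]. It starts
    after the first step, so that [F (w 0)] never appears. *)
Lemma strongly_convex_rate (r : R) (j : nat) :
  0 < r <= 1 -> L * r ^+ 2 = mu -> 0 <= L ->
  (forall u v t, C u -> C v -> 0 <= t <= 1 ->
     F (t *: u + (1 - t) *: v) <= t * F u + (1 - t) * F v
       - mu / 2 * (t * (1 - t)) * enorm (u - v) ^+ 2) ->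
  (forall i, what i.+1 = w i.+1 + ((1 - r) / (1 + r)) *: (w i.+1 - w i)) ->
  F (w j.+1) - F x <=
    (1 - r) ^+ j.+1 * (L * (enorm (w 0%N - x) * enorm (w 1%N - w 0%N))).
Proof using All.
move=> /andP[r0 r1] Lr L0 cF hatS.
pose p i := (w i.+1 - w i) + r *: (w i - x).
suff key i : F (w i.+1) - F x + L / 2 * enorm (p i) ^+ 2
    <= (1 - r) ^+ i.+1 * (L * (enorm (w 0%N - x) * enorm (w 1%N - w 0%N))).
  apply: le_trans (key j); rewrite lerDl.
  by apply: mulr_ge0 _ (sqr_ge0 _); lra.
elim: i => [|i IH].
  (* Since [mu = L * r ^+ 2], all squares cancel between the prox inequality and [p 0]. What remains
     is [(1 - r) * L] times an inner product, to which Cauchy-Schwarz applies. *)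
  have hp := hprox 0 Cx; rewrite what0 in hp; rewrite expr1 /p.
  have hcs := dot_le_enorm (w 0%N - x) (- (w 1%N - w 0%N)).
  rewrite enormN in hcs.
  have c0 : 0 <= (1 - r) * L by rewrite mulr_ge0 //; lra.
  rewrite [leRHS]mulrA; apply: le_trans (ler_wpM2l c0 hcs).
  move: hp; rewrite -Lr.
  have -> : x - w 1%N = - ((w 0%N - x) + (w 1%N - w 0%N)).
    by apply/colP => k; rewrite !mxE; ring.
  have -> : x - w 0%N = - (w 0%N - x) by rewrite opprB.
  move: (w 0%N - x) (w 1%N - w 0%N) => a d.
  rewrite !sqr_enorm !dotE (dotC d a); lra.
have r01 : 0 <= r <= 1 by rewrite (ltW r0).
have := hprox i.+1 (cC Cx (Cw i.+1) r01).
have := cF _ _ _ Cx (Cw i.+1) r01.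
set u := _ *: x + _ *: w i.+1.
have -> : u - what i.+1 = (- (1 + r)^-1) *: (p i + r ^+ 2 *: (w i.+1 - x)).
  rewrite hatS /u /p; apply/colP => k; rewrite !mxE; field; lra.
have -> : u - w i.+2 = - p i.+1.
  by rewrite /u /p; apply/colP => k; rewrite !mxE; ring.
have s0 : 0 <= 1 - r by lra.
have := ler_wpM2l s0 IH; rewrite [X in _ <= X -> _]mulrA -exprS.
rewrite enormN enormZ normrN exprMn real_normK ?num_real // (enormB x).
move: (p i) (p i.+1) (w i.+1 - x) => P Q b h1 h2 h3.
apply: le_trans h1.
(* A nonnegative multiple of this square is exactly the slack between the two sides of the
   contraction. *)
have := sqr_ge0 (enorm (P - r *: b)).
rewrite sqr_enormBZ => h4.
have E : enorm (P + r ^+ 2 *: b) ^+ 2 = enorm P ^+ 2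
    + r ^+ 2 * (2 * dot b P + r ^+ 2 * enorm b ^+ 2).
  by rewrite -[P + _]/(P + _) -[r ^+ 2 *: b]opprK -scaleNr sqr_enormBZ; ring.
rewrite E -Lr in h3; rewrite -Lr in h2.
move: (enorm P ^+ 2) (enorm b ^+ 2) (dot b P) (enorm Q ^+ 2) h2 h3 h4 => PP BB BP QQ h2 h3 h4.
have LH : 0 <= L / 2 * (1 - r) / (1 + r) * r * (PP + r * (- (2 * BP) + r * BB)).
  by rewrite !mulr_ge0 ?invr_ge0 //; lra.
have : (L - L * r ^+ 2) / 2 * ((1 + r)^-1 ^+ 2 * (PP + r ^+ 2 * (2 * BP + r ^+ 2 * BB)))
   = (1 - r) * (L / 2 * PP) + L * r ^+ 2 / 2 * (r * (1 - r)) * BB -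
   L / 2 * (1 - r) / (1 + r) * r * (PP + r * (- (2 * BP) + r * BB)).
  by field; lra.
lra.
Qed.

End Rates.

(** With [b = alpha j.+1] the recursion says that [b ^+ 2 / (1 - b)] equals [alpha j ^+ 2]. The
    quotient increases with [b], and at [b = 2 / (j + 3)] it is [4 / ((j + 1) (j + 3))], already
    more than [4 / (j + 2) ^ 2]. *)
Lemma fista_alpha_le (R : realType) (alpha : nat -> R) j :
  alpha 0%N = 1 -> (forall i, 0 < alpha i <= 1) ->
  (forall i, alpha i.+1 ^+ 2 = (1 - alpha i.+1) * alpha i ^+ 2) ->
  alpha j <= 2 / (j%:R + 2).
Proof.
move=> a0 a01 aS; elim: j => [|j IH]; first by rewrite a0 add0r divff.
have /andP[p0 p1] := a01 j; have /andP[q0 q1] := a01 j.+1.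
rewrite leNgt; apply/negP => hc.
have j0 : 0 <= j%:R :> R by [].
rewrite -[j.+1%:R]natr1 in hc.
have := aS j.
rewrite ltr_pdivrMr in hc; last lra.
rewrite ler_pdivlMr in IH; last lra.
move: (alpha j) (alpha j.+1) (j%:R) p0 p1 q0 q1 j0 hc IH => a b k p0 p1 q0 q1 k0 hc IH E.
have h1 : a ^+ 2 * (k + 2) ^+ 2 <= 4.
  have -> : a ^+ 2 * (k + 2) ^+ 2 = (a * (k + 2)) ^+ 2 by ring.
  have : 0 <= a * (k + 2) by rewrite mulr_ge0 //; lra.
  by nra.
have h2 : 0 <= 1 - b by lra.
have h3 : b ^+ 2 * (k + 2) ^+ 2 <= (1 - b) * 4.
  by rewrite E -mulrA ler_wpM2l.
have h4 : 2 - 2 * b < (k + 1) * b by lra.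
have : (1 - b) * 4 < 2 * ((k + 1) * b) by lra.
move=> h5.
have h6 : b * (b * (k + 2) ^+ 2) < b * (2 * (k + 1)) by lra.
rewrite ltr_pM2l // in h6.
nra.
Qed.

(** * The augmented Lagrangian *)

Lemma ler_dist_max0 (R : realType) (a b : R) :
  `|Num.max 0 a - Num.max 0 b| <= `|a - b|.
Proof.
rewrite ler_norml.
have := ler_norm (a - b); have := ler_norm (b - a); rewrite (distrC b).
by case: (leP 0 a) => ha; case: (leP 0 b) => hb h1 h2; apply/andP; split; lra.
Qed.

(** [psi_beta] is convex in [u] with nonnegative slope, so the increment may be replaced by a lower
    bound [d]. For [pf P i] this [d] is the linearized increment. *)
Lemma psi_beta_grad_le (R : realType) (beta u u' v d : R) : 0 < beta ->
  d <= u' - u ->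
  psi_beta beta u v + Num.max 0 (v + beta * u) * d <= psi_beta beta u' v.
Proof.
move=> b0 hd; rewrite !psi_betaE //.
have b2 : 0 < 2 * beta by lra.
rewrite ler_pdivlMr //.
have hb : beta * d <= beta * u' - beta * u by rewrite -mulrBr ler_pM2l.
set a := v + beta * u; set a' := v + beta * u'.
have ad : beta * d <= a' - a by rewrite /a /a'; lra.
have -> : ((Num.max 0 a ^+ 2 - v ^+ 2) / (2 * beta) + Num.max 0 a * d) * (2 * beta)
  = Num.max 0 a ^+ 2 - v ^+ 2 + 2 * (Num.max 0 a * (beta * d)) by field; rewrite gt_eqF.
move: (beta * d) a a' ad => D a a' h.
case: (leP 0 a) => ha; case: (leP 0 a') => ha'; try nra.
by have := ler_wpM2l ha h; have := sqr_ge0 (a' - a); nra.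
Qed.

Section Program.
Context {R : realType} {n p m : nat} {P : program R n p m} {mu : R}.
Hypothesis hP : convex_program P mu.

(** Faithful on [domX]; where [ph] is infinite, [fine] returns the default 0. *)
Definition fobj (Q : program R n p m) (x : 'cV[R]_n) : R :=
  pg Q x + fine (ph Q x).

Lemma domX_fin x : domX P x -> ph P x = (fine (ph P x))%:E.
Proof using hP.
case=> h _; case: hP => _ _ _ [/(_ x) h' _] _.
by rewrite fineK // fin_numE h' /= lt_eqF.
Qed.

Lemma objective_fobj x : domX P x -> objective P x = (fobj P x)%:E.
Proof using hP. by move=> Dx; rewrite /objective domX_fin. Qed.

Lemma segment_closed_domX : segment_closed (domX P).
Proof using hP.
move=> u v t Du Dv t01; case: (hP) => -[_ cX] _ _ [_ ch] _.
split=> /=.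
  apply: le_lt_trans (ch u v t t01) _.
  by rewrite (domX_fin Du) (domX_fin Dv) -!EFinM -EFinD ltry.
have := cX u v (Itv01 (proj1 (andP t01)) (proj2 (andP t01))).
by rewrite !inE; apply; [case: Du|case: Dv].
Qed.

Lemma convex_on_ph : convex_on (domX P) (fun x => fine (ph P x)).
Proof using hP.
move=> u v t Du Dv t01; case: (hP) => _ _ _ [_ ch] _.
have := ch u v t t01.
rewrite (domX_fin Du) (domX_fin Dv) (domX_fin (segment_closed_domX Du Dv t01)).
by rewrite -!EFinM -EFinD lee_fin.
Qed.

Lemma pf_grad_le i x u : pf P i x + dot (grad (pf P i) x) (u - x) <= pf P i u.
Proof using hP.
case: hP => _ _ _ _ /(_ i)[cf df].
suff /(strongly_convex_grad_le u)/(_ (df x)) : strongly_convex 0 (pf P i).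
  by rewrite !mul0r addr0.
move=> a b t t01; rewrite !mul0r subr0.
have := cf (Itv01 (proj1 (andP t01)) (proj2 (andP t01))) a b.
by rewrite !inE; apply.
Qed.

Lemma pg_gradient_ineq : gradient_ineq mu (pg P) (grad (pg P)).
Proof using hP.
by case: hP => _ [_ cg] dg _ _ x u; apply: strongly_convex_grad_le.
Qed.

Section Lagrangian.
Context {beta : R} (y : 'cV[R]_p) (z : 'cV[R]_m).
Hypothesis b0 : 0 < beta.

(** The gradient of the ordinary smooth Lagrangian at the multipliers updated with step [beta]. *)
Definition al_grad (x : 'cV[R]_n) : 'cV[R]_n :=
  grad (pg P) x + (pA P)^T *m (y + beta *: (pA P *m x - pb P))
  + \sum_(i < m) Num.max 0 (z i 0 + beta * pf P i x) *: grad (pf P i) x.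

Lemma quad_expansion x v :
  dot y (pA P *m (x + v) - pb P) + beta / 2 * enorm (pA P *m (x + v) - pb P) ^+ 2
  = dot y (pA P *m x - pb P) + beta / 2 * enorm (pA P *m x - pb P) ^+ 2
    + dot ((pA P)^T *m (y + beta *: (pA P *m x - pb P))) v
    + beta / 2 * enorm (pA P *m v) ^+ 2.
Proof using.
have -> : pA P *m (x + v) - pb P = (pA P *m x - pb P) + pA P *m v.
  by rewrite mulmxDr addrAC.
rewrite dot_trmx.
move: (pA P *m x - pb P) (pA P *m v) => a b.
by rewrite !sqr_enorm !dotE (dotC b a); field.
Qed.

Lemma grad_aug_lagrangian_smooth x :
  grad (aug_lagrangian_smooth P beta y z) x = al_grad x.
Proof using hP b0.
apply/colP => k; rewrite mxE.
set e := delta_mx k 0.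
rewrite -dot_delta -/e.
case: (hP) => _ _ dg _ hf.
have D1 : is_derive x e (pg P) (dot (grad (pg P) x) e).
  by rewrite dot_grad //; apply: derivableP; exact: diff_derivable.
pose Q u := dot y (pA P *m u - pb P) + beta / 2 * enorm (pA P *m u - pb P) ^+ 2.
have D2 : is_derive x e Q
    (dot ((pA P)^T *m (y + beta *: (pA P *m x - pb P))) e).
  apply: (@is_derive_quad _ _ _ _ _ _ (beta / 2 * enorm (pA P *m e) ^+ 2)) => h.
  rewrite [h *: e + x]addrC /Q quad_expansion dotZr -scalemxAr enormZ exprMn.
  rewrite real_normK ?num_real // ger0_norm.
    by rewrite le_eqVlt; apply/orP; left; apply/eqP; ring.
  set a := dot y _ + _; set c := h * dot _ e.
  have -> : a + c + beta / 2 * (h ^+ 2 * enorm (pA P *m e) ^+ 2) - a - c =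
    beta / 2 * (h ^+ 2 * enorm (pA P *m e) ^+ 2) by ring.
  by exact: mulr_ge0 (divr_ge0 (ltW b0) _) (mulr_ge0 (sqr_ge0 _) (sqr_ge0 _)).
have D3 i : is_derive x e ((psi_beta beta)^~ (z i 0) \o pf P i)
    (Num.max 0 (z i 0 + beta * pf P i x) * dot (grad (pf P i) x) e).
  by apply: is_derive_comp_dir (is_derive_psi_beta _ _ b0); case: (hf i).
have -> : aug_lagrangian_smooth P beta y z =
    pg P + (Q + \sum_(i < m) ((psi_beta beta)^~ (z i 0) \o pf P i)).
  by apply/funext => u; rewrite /= /aug_lagrangian_smooth /lagrangian_terms fct_sumE.
have D4 := is_deriveD D1 (is_deriveD D2 (is_derive_sum D3)).
rewrite (@derive_val _ _ _ _ _ _ _ D4) !dotDl addrA dot_suml; congr (_ + _).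
by apply: eq_bigr => i _; rewrite dotZl.
Qed.

Lemma al_gradient_ineq : gradient_ineq mu (aug_lagrangian_smooth P beta y z)
  (grad (aug_lagrangian_smooth P beta y z)).
Proof using hP b0.
move=> x u; rewrite grad_aug_lagrangian_smooth.
rewrite /aug_lagrangian_smooth /lagrangian_terms !dotDl dot_suml.
have h1 := pg_gradient_ineq x u.
have h2 := quad_expansion x (u - x); rewrite [x + _]addrC subrK in h2; rewrite h2.
have h3 : 0 <= beta / 2 * enorm (pA P *m (u - x)) ^+ 2.
  exact: mulr_ge0 (divr_ge0 (ltW b0) _) (sqr_ge0 _).
have h4 : \sum_(i < m) psi_beta beta (pf P i x) (z i 0) +
    \sum_(i < m) dot (Num.max 0 (z i 0 + beta * pf P i x) *: grad (pf P i) x) (u - x)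
    <= \sum_(i < m) psi_beta beta (pf P i u) (z i 0).
  rewrite -big_split ler_sum // => i _ /=; rewrite dotZl.
  apply: psi_beta_grad_le => //; rewrite lerBrDl; exact: pf_grad_le.
move: h1 h3 h4; lra.
Qed.

Context {L0 : R} {L B : 'I_m -> R}.
Hypothesis hreg : regularity_constants P L0 L B.

Lemma B_ge0 x i : domX P x -> 0 <= B i.
Proof using hreg.
case: hreg => _ _ hB _ Dx; apply: le_trans (hB i x Dx).
by rewrite le_max normr_ge0.
Qed.

(** Term by term. For a constraint, the difference of the products multiplier times gradient is
    split as in the product rule: the multiplier is [beta * B i]-Lipschitz and bounded by
    [|z i 0| + beta * B i]. *)
Lemma al_lipschitz : elipschitz_on (solver_lipschitz P L0 L B beta z) (domX P)
  (grad (aug_lagrangian_smooth P beta y z)).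
Proof using hP b0 hreg.
move=> u v Du Dv; rewrite !grad_aug_lagrangian_smooth /al_grad.
case: (hreg) => -[L00 Lg] Lf hB Bf.
pose s x := \sum_(i < m)
  Num.max 0 (z i 0 + beta * pf P i x) *: grad (pf P i) x.
rewrite -/(s u) -/(s v).
have split3 (a b c a' b' c' : 'cV[R]_n) :
    a + b + c - (a' + b' + c') = (a - a') + (b - b') + (c - c').
  by apply/colP => j; rewrite !mxE; ring.
have quadE : (pA P)^T *m (y + beta *: (pA P *m u - pb P))
    - (pA P)^T *m (y + beta *: (pA P *m v - pb P))
    = beta *: ((pA P)^T *m pA P *m (u - v)).
  rewrite -mulmxBr opprD addrACA subrr add0r -scalerBr opprB addrA subrK.
  by rewrite -mulmxBr -scalemxAr mulmxA.
rewrite split3 quadE.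
rewrite /solver_lipschitz !mulrDl.
apply: (le_trans (ler_enormD _ _)); apply: lerD.
  apply: (le_trans (ler_enormD _ _)); apply: lerD; first exact: Lg.
  by rewrite enormZ (gtr0_norm b0) -mulrA ler_pM2l // enorm_mulmx_le.
rewrite /s -sumrB mulr_suml.
apply: (le_trans (ler_enorm_sum _ _)); apply: ler_sum => i _.
have [Li Lfi] := Lf i.
have Bi : 0 <= B i := B_ge0 i Du.
pose c x := Num.max 0 (z i 0 + beta * pf P i x).
rewrite -/(c u) -/(c v).
have -> : c u *: grad (pf P i) u - c v *: grad (pf P i) v =
  (c u - c v) *: grad (pf P i) u + c v *: (grad (pf P i) u - grad (pf P i) v).
  by apply/colP => j; rewrite !mxE; ring.
apply: (le_trans (ler_enormD _ _)); rewrite !enormZ.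
have h1 : `|c u - c v| <= beta * B i * enorm (u - v).
  apply: (le_trans (ler_dist_max0 _ _)); rewrite opprD addrACA subrr add0r.
  by rewrite -mulrBr normrM (gtr0_norm b0) -mulrA ler_pM2l // Bf.
have h2 : enorm (grad (pf P i) u) <= B i.
  by apply: le_trans (hB i u Du); rewrite le_max lexx orbT.
have h3 : `|c v| <= `|z i 0| + beta * B i.
  have hf : `|pf P i v| <= B i.
    by apply: le_trans (hB i v Dv); rewrite le_max lexx.
  rewrite ger0_norm; last by rewrite le_max lexx.
  rewrite ge_max addr_ge0 ?mulr_ge0 ?(ltW b0) //=.
  apply: lerD; rewrite ?ler_norm // ler_pM2l //.
  exact: le_trans (ler_norm _) hf.
have h4 := Lfi u v Du Dv.
have k1 : `|c u - c v| * enorm (grad (pf P i) u) <=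
    beta * B i * enorm (u - v) * B i.
  by apply: ler_pM => //; exact: enorm_ge0.
have k2 : `|c v| * enorm (grad (pf P i) u - grad (pf P i) v) <=
    (`|z i 0| + beta * B i) * (L i * enorm (u - v)).
  by apply: ler_pM => //; exact: enorm_ge0.
apply: (le_trans (lerD k1 k2)); rewrite le_eqVlt; apply/orP; left; apply/eqP.
by ring.
Qed.

Definition al_val (x : 'cV[R]_n) : R :=
  aug_lagrangian_smooth P beta y z x + fine (ph P x).

Lemma aug_lagrangianE x : domX P x -> aug_lagrangian P beta y z x = (al_val x)%:E.
Proof using hP.
move=> Dx; rewrite /aug_lagrangian (objective_fobj Dx) -EFinD /al_val.
by rewrite /fobj /aug_lagrangian_smooth addrAC.
Qed.

(** Turns the extended infimum into real inequalities. The feasible point [x1] makes the infimum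
    smaller than [+oo], which forces an accurate [x] into [domX]. *)
Lemma accurateP e x x1 : domX P x1 ->
  accurate P beta y z e x <->
  domX P x /\ forall u, domX P u -> al_val x <= al_val u + e.
Proof using hP.
move=> Dx1; split=> [[Xx hx]|[Dx hx]].
  have hu u : domX P u -> (aug_lagrangian P beta y z x <= (al_val u + e)%:E)%E.
    move=> Du; apply: (le_trans hx); rewrite EFinD leeD2r //.
    apply: ereal_inf_lbound; exists u; first by case: Du.
    exact: aug_lagrangianE.
  have Dx : domX P x.
    split=> //=; have := hu _ Dx1; rewrite /aug_lagrangian /objective.
    case: (ph P x) => [r| |] //=; rewrite ?ltry //.
  split=> // u Du; have := hu u Du; by rewrite aug_lagrangianE // lee_fin.
split; first by case: Dx.
rewrite -leeBlDr //; apply: le_ereal_inf_tmp => _ [u Xu <-].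
have [hu|hu] := boolP (ph P u < +oo)%E; last first.
  have hi : ph P u = +oo%E by apply/eqP; rewrite -leye_eq leNgt.
  by rewrite /aug_lagrangian /objective hi addey // addye // leey.
have Du : domX P u by [].
by rewrite leeBlDr // !aug_lagrangianE // -EFinD lee_fin hx.
Qed.

End Lagrangian.

End Program.

(** * Outer iterations *)

Lemma jensen_mean (R : realType) (n : nat) (C : set 'cV[R]_n) F
    (x : nat -> 'cV[R]_n) K :
  segment_closed C -> convex_on C F -> (forall t, (t < K.+1)%N -> C (x t)) ->
  C (K.+1%:R^-1 *: \sum_(t < K.+1) x t) /\
  F (K.+1%:R^-1 *: \sum_(t < K.+1) x t) <= K.+1%:R^-1 * \sum_(t < K.+1) F (x t).
Proof.
move=> cC cF; elim: K => [|K IH] Cx.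
  by rewrite !big_ord1 invr1 scale1r mul1r; split=> //; exact: Cx.
have [Ca Fa] := IH (fun t ht => Cx t (ltnW ht)).
set a := K.+1%:R^-1 *: \sum_(t < K.+1) x t in Ca Fa.
pose s : R := K.+1%:R / K.+2%:R.
have k0 : 0 < K.+1%:R :> R by rewrite ltr0n.
have k2 : K.+2%:R = K.+1%:R + 1 :> R by rewrite natr1.
have s01 : 0 <= s <= 1.
  by rewrite /s k2 divr_ge0 ?(ltW k0) //= ?ler_pdivrMr; lra.
have -> : K.+2%:R^-1 *: \sum_(t < K.+2) x t = s *: a + (1 - s) *: x K.+1.
  rewrite big_ord_recr /= /s /a k2 scalerDr scalerA; congr (_ *: _ + _ *: _).
    by field; lra.
  by field; lra.
have Cl : C (x K.+1) by exact: Cx.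
split; first exact: cC.
apply: (le_trans (cF _ _ _ Ca Cl s01)).
have -> : K.+2%:R^-1 * \sum_(t < K.+2) F (x t) =
    s * (K.+1%:R^-1 * \sum_(t < K.+1) F (x t)) + (1 - s) * F (x K.+1).
  by rewrite big_ord_recr /= /s k2; field; lra.
by rewrite lerD2r ler_wpM2l //; case/andP: s01.
Qed.

Lemma exists_aligned (R : realType) (n : nat) (r : 'cV[R]_n) (c : R) : 0 <= c ->
  exists2 v, dot v r = c * enorm r & enorm v ^+ 2 <= c ^+ 2.
Proof.
move=> c0; have [r0|r0] := eqVneq (enorm r) 0.
  by exists 0; [rewrite dot0l r0 mulr0 | rewrite enorm0 expr0n sqr_ge0].
exists ((c / enorm r) *: r); first by rewrite dotZl -sqr_enorm; field.
by rewrite enormZ exprMn real_normK ?num_real // exprMn exprVn mulfVK // expf_neq0.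
Qed.

Lemma pos_part_ge0 (R : realType) (m : nat) (u : 'cV[R]_m) i :
  0 <= pos_part u i 0.
Proof. by rewrite mxE le_max lexx. Qed.

(** The witness points along [pos_part u], which is nonnegative and pairs with [u] as with itself. A
    vanishing positive part is treated apart because of the normalization. *)
Lemma exists_aligned_pos (R : realType) (m : nat) (u : 'cV[R]_m) (c : R) : 0 <= c ->
  exists v : 'cV[R]_m, [/\ forall i, 0 <= v i 0, dot v u = c * enorm (pos_part u) &
                enorm v ^+ 2 <= c ^+ 2].
Proof.
move=> c0; have [r0|r0] := eqVneq (enorm (pos_part u)) 0.
  exists 0; split; rewrite ?dot0l ?r0 ?mulr0 // ?enorm0 ?expr0n ?sqr_ge0 //.
  by move=> i; rewrite mxE.
exists ((c / enorm (pos_part u)) *: pos_part u); split.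
- by move=> i; rewrite mxE mulr_ge0 ?pos_part_ge0 ?divr_ge0 ?enorm_ge0.
- have -> : dot ((c / enorm (pos_part u)) *: pos_part u) u =
     (c / enorm (pos_part u)) * dot (pos_part u) (pos_part u).
    rewrite dotZl; congr (_ * _); apply: eq_bigr => i _; rewrite mxE.
    by case: leP => h; rewrite ?mul0r.
  by rewrite -sqr_enorm; field.
- by rewrite enormZ exprMn real_normK ?num_real // exprMn exprVn mulfVK // expf_neq0.
Qed.

Section Alm.
Context {R : realType} {n p m : nat} {P : program R n p m} {mu : R}.
Hypothesis hP : convex_program P mu.
Context {xs : 'cV[R]_n} {ys : 'cV[R]_p} {zs : 'cV[R]_m}.
Hypothesis hkkt : kkt_point P xs ys zs.

Lemma kkt_domX : domX P xs.
Proof using hkkt.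
case: hkkt => -[v [w [[hf _] _ _]]] _ Xx _; split=> //=.
move: hf; rewrite /objective; case: (ph P xs) => [r| |] //=; rewrite ?ltry //.
Qed.

Definition lagrangian (Q : program R n p m) (y : 'cV[R]_p) (z : 'cV[R]_m)
    (x : 'cV[R]_n) : R :=
  fobj Q x + dot y (pA Q *m x - pb Q) + dot z (constraints Q x).

(** Saddle-point inequality: pair the stationarity equation with [u - xs] and use the subgradient,
    the normal cone, convexity of the constraints and complementarity. *)
Lemma kkt_lagrangian_ge u : domX P u -> fobj P xs <= lagrangian P ys zs u.
Proof using hP hkkt.
move=> Du; have Ds := kkt_domX.
case: (hkkt) => -[v [w [[_ hv] [_ hw] E]]] Ab _ hz.
have := hv u; rewrite (objective_fobj hP Ds) (objective_fobj hP Du) -EFinD lee_fin.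
move=> h1; have h2 := hw u (proj2 Du).
have : dot (v + w + (pA P)^T *m ys
            + \sum_(i < m) zs i 0 *: grad (pf P i) xs) (u - xs) = 0.
  by rewrite E dot0l.
rewrite !dotDl dot_trmx dot_suml mulmxBr Ab => h3.
have h4 : \sum_(i < m) dot (zs i 0 *: grad (pf P i) xs) (u - xs) <=
    dot zs (constraints P u).
  apply: ler_sum => i _; have [z0 _ zf] := hz i; rewrite dotZl mxE.
  have := ler_wpM2l z0 (pf_grad_le hP i xs u); rewrite mulrDr zf add0r.
  by [].
rewrite /lagrangian; lra.
Qed.

Lemma convex_on_lagrangian (y : 'cV[R]_p) (z : 'cV[R]_m) : (forall i, 0 <= z i 0) ->
  convex_on (domX P) (lagrangian P y z).
Proof using hP.
move=> z0 u v t Du Dv t01; rewrite /lagrangian /fobj.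
have mu0 : 0 <= mu by case: hP => _ [].
have hg := gradient_ineq_conv u v (gradient_ineq_le mu0 (pg_gradient_ineq hP)) t01.
have hh := convex_on_ph hP Du Dv t01.
rewrite mulmxDr -!scalemxAr.
have -> : t *: (pA P *m u) + (1 - t) *: (pA P *m v) - pb P =
   t *: (pA P *m u - pb P) + (1 - t) *: (pA P *m v - pb P).
  by rewrite !scalerBr addrACA -opprD -scalerDl addrCA subrr addr0 scale1r.
rewrite dotDr !dotZr.
have hf : dot z (constraints P (t *: u + (1 - t) *: v)) <=
   t * dot z (constraints P u) + (1 - t) * dot z (constraints P v).
  rewrite -!dotZr -dotDr; apply: ler_sum => i _; rewrite !mxE.
  rewrite ler_wpM2l //.
  have := @gradient_ineq_conv _ _ (pf P i) (grad (pf P i)) 0 u v t.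
  rewrite !mul0r subr0; apply=> // a b.
  by rewrite !mul0r addr0; exact: pf_grad_le hP i a b.
move: hg hh hf; rewrite !mul0r subr0; lra.
Qed.

Section Step.
Context {beta e : R} {x : 'cV[R]_n} {y : 'cV[R]_p} {z : 'cV[R]_m}.
Hypothesis b0 : 0 < beta.
Hypothesis hx : accurate P beta y z e x.

Let z' := update_z P beta beta z x.
Let y' := update_y P beta y x.

(** With [rho = beta] the update is a projected gradient step on the dual, so multipliers stay
    nonnegative. *)
Lemma update_zE i : z' i 0 = Num.max 0 (z i 0 + beta * pf P i x).
Proof using b0.
rewrite /z' mxE maxr_pMr ?(ltW b0) //.
have -> : beta * - (z i 0 / beta) = - z i 0 by field; rewrite gt_eqF.
by rewrite addr_maxr subrr.
Qed.

Lemma update_z_ge0 i : 0 <= z' i 0.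
Proof using b0. by rewrite update_zE le_max lexx. Qed.

(* With [rho = beta] the penalty terms are exactly
   [(|y'|^2 - |y|^2 + |z'|^2 - |z|^2) / (2 beta)], so that testing against an
   arbitrary dual point [(yy, zz)] gives a telescoping inequality. *)
Lemma alm_step (yy : 'cV[R]_p) (zz : 'cV[R]_m) :
  (forall i, 0 <= z i 0) -> (forall i, 0 <= zz i 0) ->
  domX P x /\
  beta * (lagrangian P yy zz x - fobj P xs)
    + 2^-1 * (enorm (y' - yy) ^+ 2 + enorm (z' - zz) ^+ 2) <=
  beta * e + 2^-1 * (enorm (y - yy) ^+ 2 + enorm (z - zz) ^+ 2).
Proof using hP hkkt b0 hx.
move=> z0 zz0; have Ds := kkt_domX.
have [Dx /(_ _ Ds) hv] := (accurateP hP y z e x Ds).1 hx.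
split=> //; move: hv.
rewrite /al_val /aug_lagrangian_smooth /lagrangian_terms.
case: (hkkt) => _ Ab _ hz.
rewrite Ab subrr enorm0 dot0r expr0n mulr0 addr0 add0r.
have hs : \sum_(i < m) psi_beta beta (pf P i xs) (z i 0) <= 0.
  apply: sumr_le0 => i _; rewrite psi_betaE // ler_pdivrMr ?mulr_gt0 // mul0r.
  have [_ f0 _] := hz i; have hb : beta * pf P i xs <= 0 by rewrite pmulr_rle0.
  rewrite subr_le0 ler_pXn2r ?nnegrE ?z0 // ?le_max ?lexx // ge_max z0 /=.
  by rewrite gerDl.
have hpsi : \sum_(i < m) psi_beta beta (pf P i x) (z i 0) =
    (2 * beta)^-1 * (dot z' z' - dot z z).
  rewrite /dot -sumrB mulr_sumr; apply: eq_bigr => i _.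
  by rewrite psi_betaE // update_zE !expr2 mulrC.
(* Each [z' i 0] dominates [z i 0 + beta * pf P i x], and the nonnegative weights [zz] preserve
   this. *)
have hzz : beta * dot zz (constraints P x) <= dot zz z' - dot zz z.
  rewrite /dot mulr_sumr -sumrB; apply: ler_sum => i _.
  rewrite -mulrBr mulrCA ler_wpM2l // update_zE mxE lerBrDl.
  by rewrite le_max lexx orbT.
rewrite hpsi /lagrangian /fobj /y' /update_y.
move: (pA P *m x - pb P) => r hv.
have {}hv : beta * (pg P x + fine (ph P x) - pg P xs - fine (ph P xs)
   + dot y r + beta / 2 * enorm r ^+ 2) + 2^-1 * (dot z' z' - dot z z) <= beta * e.
  have -> : 2^-1 * (dot z' z' - dot z z) =
      beta * ((2 * beta)^-1 * (dot z' z' - dot z z)).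
    by field; rewrite gt_eqF.
  by rewrite -mulrDr ler_pM2l //; lra.
move: z' hzz hv {hpsi} => z1 hzz hv.
rewrite !sqr_enorm !dotE in hv *.
rewrite (dotC r y) (dotC r yy) (dotC yy y) (dotC z1 zz) (dotC z zz); lra.
Qed.

End Step.

(** * Telescoping and multiplier bounds over the first [k] outer iterations *)

Section Run.
Context {beta e : R} {x : nat -> 'cV[R]_n} {y : nat -> 'cV[R]_p}
  {z : nat -> 'cV[R]_m} {k : nat}.
Hypothesis b0 : 0 < beta.
Hypothesis y0 : y 0%N = 0.
Hypothesis z0 : z 0%N = 0.
Hypothesis run : forall t, (t < k)%N ->
  [/\ accurate P beta (y t) (z t) e (x t.+1),
      y t.+1 = update_y P beta (y t) (x t.+1) &
      z t.+1 = update_z P beta beta (z t) (x t.+1)].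

Lemma run_z_ge0 t i : (t <= k)%N -> 0 <= z t i 0.
Proof using b0 z0 run.
case: t => [_|t ht]; first by rewrite z0 mxE.
by have [_ _ ->] := run ht; exact: update_z_ge0.
Qed.

Lemma run_domX t : (t < k)%N -> domX P (x t.+1).
Proof using hP hkkt run.
move=> ht; have [hx _ _] := run ht.
exact: (proj1 ((accurateP hP _ _ _ _ kkt_domX).1 hx)).
Qed.

Lemma alm_sum (yy : 'cV[R]_p) (zz : 'cV[R]_m) : (forall i, 0 <= zz i 0) ->
  beta * (\sum_(t < k) (lagrangian P yy zz (x t.+1) - fobj P xs))
    + 2^-1 * (enorm (y k - yy) ^+ 2 + enorm (z k - zz) ^+ 2) <=
  k%:R * (beta * e) + 2^-1 * (enorm yy ^+ 2 + enorm zz ^+ 2).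
Proof using hP hkkt b0 y0 z0 run.
move=> zz0; suff key j : (j <= k)%N ->
  beta * (\sum_(t < j) (lagrangian P yy zz (x t.+1) - fobj P xs))
    + 2^-1 * (enorm (y j - yy) ^+ 2 + enorm (z j - zz) ^+ 2) <=
  j%:R * (beta * e) + 2^-1 * (enorm yy ^+ 2 + enorm zz ^+ 2) by exact: key.
elim: j => [_|j IH hj].
  by rewrite big_ord0 mulr0 mul0r !add0r y0 z0 !sub0r !enormN.
have {}IH := IH (ltnW hj).
have [hx hy hz] := run hj.
have [_] := alm_step b0 hx yy (fun i => run_z_ge0 i (ltnW hj)) zz0.
rewrite -hy -hz big_ord_recr /= -[j.+1%:R]natr1; lra.
Qed.

Lemma run_z_bound :
  enorm (z k - zs) ^+ 2 <= 2 * (k%:R * (beta * e)) + enorm ys ^+ 2 + enorm zs ^+ 2.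
Proof using hP hkkt b0 y0 z0 run.
have zs0 i : 0 <= zs i 0 by case: hkkt => _ _ _ /(_ i)[].
have := alm_sum ys zs0.
have : 0 <= beta * (\sum_(t < k) (lagrangian P ys zs (x t.+1) - fobj P xs)).
  apply: mulr_ge0 (ltW b0) _; apply: sumr_ge0 => t _; rewrite subr_ge0.
  exact: kkt_lagrangian_ge (run_domX _).
have := sqr_ge0 (enorm (y k - ys)); lra.
Qed.

End Run.

(** * Error bounds for the averaged iterate *)

Section Ergodic.
Context {beta e : R} {x : nat -> 'cV[R]_n} {y : nat -> 'cV[R]_p}
  {z : nat -> 'cV[R]_m} {K : nat}.
Hypothesis b0 : 0 < beta.
Hypothesis K0 : (0 < K)%N.
Hypothesis y0 : y 0%N = 0.
Hypothesis z0 : z 0%N = 0.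
Hypothesis run : forall t, (t < K)%N ->
  [/\ accurate P beta (y t) (z t) e (x t.+1),
      y t.+1 = update_y P beta (y t) (x t.+1) &
      z t.+1 = update_z P beta beta (z t) (x t.+1)].
Let xbar := weighted_average K (fun=> beta) x.
Let res := enorm (pA P *m xbar - pb P).
Let viol := enorm (pos_part (constraints P xbar)).

Lemma ergodic_lagrangian : domX P xbar /\
  forall (yy : 'cV[R]_p) (zz : 'cV[R]_m), (forall i, 0 <= zz i 0) ->
  lagrangian P yy zz xbar - fobj P xs <=
    e + (enorm yy ^+ 2 + enorm zz ^+ 2) / (2 * (K%:R * beta)).
Proof using hP hkkt b0 K0 y0 z0 run.
have kr : 0 < K%:R :> R by rewrite ltr0n.
have -> : xbar = K%:R^-1 *: \sum_(t < K) x t.+1.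
  rewrite /xbar /weighted_average sumr_const card_ord -scaler_sumr scalerA.
  by congr (_ *: _); rewrite -[beta *+ K]mulr_natr; field; rewrite !gt_eqF.
have KE : K = K.-1.+1 by rewrite prednK.
have J (yy : 'cV[R]_p) (zz : 'cV[R]_m) (zz0 : forall i, 0 <= zz i 0) :
    domX P (K%:R^-1 *: \sum_(t < K) x t.+1) /\
    lagrangian P yy zz (K%:R^-1 *: \sum_(t < K) x t.+1) <=
      K%:R^-1 * \sum_(t < K) lagrangian P yy zz (x t.+1).
  have := @jensen_mean _ _ (domX P) (lagrangian P yy zz) (fun t => x t.+1) K.-1.
  rewrite -KE; apply; first exact: segment_closed_domX hP.
    exact: convex_on_lagrangian.
  by move=> t ht; apply: (run_domX run).
split=> [|yy zz zz0].
  by have [] := J 0 0; first by move=> i; rewrite mxE.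
have [_ hJ] := J yy zz zz0.
have hs := alm_sum b0 y0 z0 run yy zz0.
rewrite sumrB sumr_const card_ord in hs.
have h0 : 0 <= 2^-1 * (enorm (y K - yy) ^+ 2 + enorm (z K - zz) ^+ 2).
  by rewrite mulr_ge0 ?addr_ge0 ?sqr_ge0.
have bk : 0 < K%:R * beta by rewrite mulr_gt0.
set S := \sum_(t < K) lagrangian P yy zz (x t.+1) in hJ hs *.
apply: (@le_trans _ _ (K%:R^-1 * S - fobj P xs)).
  by rewrite lerD2r.
rewrite -(ler_pM2l bk).
have -> : K%:R * beta * (K%:R^-1 * S - fobj P xs)
  = beta * (S - fobj P xs *+ K).
  by rewrite -mulr_natr; field; rewrite gt_eqF.
have -> : K%:R * beta * (e + (enorm yy ^+ 2 + enorm zz ^+ 2) / (2 * (K%:R * beta)))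
  = K%:R * (beta * e) + 2^-1 * (enorm yy ^+ 2 + enorm zz ^+ 2).
  by field; rewrite !gt_eqF.
lra.
Qed.

(** Dual vectors of norms at most [c] and [d], aligned with the residuals, turn inner products into
    norms. The weights stay free for the choices made below. *)
Lemma ergodic_penalty c d : 0 <= c -> 0 <= d ->
  fobj P xbar - fobj P xs + c * res + d * viol <=
    e + (c ^+ 2 + d ^+ 2) / (2 * (K%:R * beta)).
Proof using hP hkkt b0 K0 y0 z0 run.
move=> c0 d0.
have [yy hy ny] := exists_aligned (pA P *m xbar - pb P) c0.
have [zz [zz0 hz nz]] := exists_aligned_pos (constraints P xbar) d0.
have [_ /(_ yy zz zz0)] := ergodic_lagrangian.
rewrite /lagrangian hy hz -/res -/viol => h.
have : (enorm yy ^+ 2 + enorm zz ^+ 2) / (2 * (K%:R * beta)) <=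
    (c ^+ 2 + d ^+ 2) / (2 * (K%:R * beta)).
  rewrite ler_wpM2r ?lerD // invr_ge0 mulr_ge0 //.
  by rewrite mulr_ge0 // ltW.
lra.
Qed.

Lemma ergodic_ge : - (enorm ys * res + enorm zs * viol) <= fobj P xbar - fobj P xs.
Proof using hP hkkt b0 K0 y0 z0 run.
have [Db _] := ergodic_lagrangian.
have := kkt_lagrangian_ge Db; rewrite /lagrangian.
have := dot_le_enorm ys (pA P *m xbar - pb P).
have : dot zs (constraints P xbar) <= enorm zs * viol.
  apply: le_trans (dot_le_enorm _ _); apply: ler_sum => i _.
  have zs0 : 0 <= zs i 0 by case: hkkt => _ _ _ /(_ i)[].
  by rewrite ler_wpM2l // [leRHS]mxE le_max lexx orbT.
rewrite /res; lra.
Qed.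

(** Weights one larger than the norms of the KKT multipliers leave coefficient 1 on each residual
    once [ergodic_ge] is subtracted. *)
Lemma ergodic_infeasibility :
  res + viol <=
    e + ((1 + enorm ys) ^+ 2 + (1 + enorm zs) ^+ 2) / (2 * (K%:R * beta)).
Proof using hP hkkt b0 K0 y0 z0 run.
have h1 : 0 <= 1 + enorm ys by rewrite addr_ge0 ?enorm_ge0.
have h2 : 0 <= 1 + enorm zs by rewrite addr_ge0 ?enorm_ge0.
have := ergodic_penalty h1 h2; have := ergodic_ge; lra.
Qed.

(** Zero weights give the upper bound. Doubled multiplier norms, combined with [ergodic_ge], bound
    [enorm ys * res + enorm zs * viol] by the right-hand side, and [ergodic_ge] again gives the
    lower bound. *)
Lemma ergodic_objective :
  `|fobj P xbar - fobj P xs| <=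
    e + (2 * enorm ys ^+ 2 + 2 * enorm zs ^+ 2) / (K%:R * beta).
Proof using hP hkkt b0 K0 y0 z0 run.
have h1 : 0 <= 2 * enorm ys by rewrite mulr_ge0 ?enorm_ge0.
have h2 : 0 <= 2 * enorm zs by rewrite mulr_ge0 ?enorm_ge0.
have := ergodic_penalty h1 h2; have := ergodic_penalty (lexx 0) (lexx 0).
have := ergodic_ge.
have k0 : 0 < K%:R :> R by rewrite ltr0n.
have kb : 0 < K%:R * beta by rewrite mulr_gt0.
have -> : ((2 * enorm ys) ^+ 2 + (2 * enorm zs) ^+ 2) / (2 * (K%:R * beta)) =
  (2 * enorm ys ^+ 2 + 2 * enorm zs ^+ 2) / (K%:R * beta).
  by field; rewrite (gt_eqF b0) (gt_eqF k0).
have q0 : 0 <= (2 * enorm ys ^+ 2 + 2 * enorm zs ^+ 2) / (K%:R * beta).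
  by rewrite divr_ge0 ?(ltW kb) // addr_ge0 // mulr_ge0 // sqr_ge0.
rewrite !expr0n /= addr0 mul0r ler_norml => A1 A2 A3.
apply/andP; split; lra.
Qed.

End Ergodic.

End Alm.

(** * Inner iterations *)

(** The update of [alpha] is the positive root of this quadratic equation, the form in which the
    rates use it. *)
Lemma alpha_recP (R : realType) (q a a' : R) : 0 < a ->
  a' = (q - a ^+ 2 + Num.sqrt ((q - a ^+ 2) ^+ 2 + 4 * a ^+ 2)) / 2 ->
  0 < a' /\ a' ^+ 2 = (1 - a') * a ^+ 2 + q * a'.
Proof.
move=> a0 ->; set d := q - a ^+ 2; set S := Num.sqrt _.
have a2 : 0 < a ^+ 2 by rewrite exprn_gt0.
have S2 : S ^+ 2 = d ^+ 2 + 4 * a ^+ 2.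
  by rewrite sqr_sqrtr // addr_ge0 ?sqr_ge0 // mulr_ge0 // ltW.
have S0 : 0 <= S by exact: sqrtr_ge0.
have dS : - d < S.
  rewrite ltNge; apply/negP => h.
  have : S ^+ 2 <= (- d) ^+ 2 by rewrite ler_pXn2r ?nnegrE //; lra.
  rewrite S2 sqrrN; lra.
split; first by rewrite divr_gt0 //; lra.
have -> : q = d + a ^+ 2 by rewrite /d; ring.
have -> : ((d + S) / 2) ^+ 2 = (d ^+ 2 + 2 * d * S + S ^+ 2) / 4 by field.
by rewrite S2; field.
Qed.

(** Keep [v], shrink the factor to [t * s], and replace [u] by the convex combination of [u] and [w]
    that [l] prescribes. The descent lemma needs this along the segment from a search point to the
    next iterate. *)
Lemma extrapolation_region_segment (R : realType) (n : nat)
    (C : set 'cV[R]_n) p w t : segment_closed C ->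
  extrapolation_region C p -> C w -> 0 <= t <= 1 ->
  extrapolation_region C (t *: p + (1 - t) *: w).
Proof.
move=> cC [u [v [s [Cu Cv /andP[s0 s1] ->]]]] Cw /andP[t0 t1].
have ts0 : 0 <= t * s by rewrite mulr_ge0.
have ts1 : t * s <= 1 by rewrite mulr_ile1.
pose l := t * (1 + s) / (1 + t * s).
exists (l *: u + (1 - l) *: w), v, (t * s); split=> //; last 1 first.
- by rewrite /l; apply/colP => i; rewrite !mxE; field; lra.
- apply: cC => //; rewrite /l divr_ge0 /= ?mulr_ge0 //; try lra.
  by rewrite ler_pdivrMr; lra.
- by rewrite ts0.
Qed.

Section Solver.
Context {R : realType} {n p m : nat} {P : program R n p m} {mu L0 : R}
  {L B : 'I_m -> R}.
Hypothesis hP : convex_program P mu.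
Hypothesis hreg : regularity_constants P L0 L B.
Hypothesis hdom : bounded_set (domX P).
Context {beta : R} {y : 'cV[R]_p} {z : 'cV[R]_m} {w0 : 'cV[R]_n}
  {w what : nat -> 'cV[R]_n} {alpha : nat -> R}.
Hypothesis b0 : 0 < beta.
Hypothesis Dw0 : domX P w0.

Let phi := aug_lagrangian_smooth P beta y z.
Let Lphi := solver_lipschitz P L0 L B beta z.
Let D := diam (domX P).

Hypothesis hsm : smooth_at_extrapolated P L0 L B beta y z.
Hypothesis hN : nesterov_iterates phi
  (fun u => (ph P u + eindicator (pX P) u)%E) Lphi mu w0 w what alpha.

Lemma solver_lipschitz_ge : L0 <= Lphi.
Proof using hreg b0 Dw0.
rewrite /Lphi /solver_lipschitz -addrA lerDl addr_ge0 //.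
  by rewrite mulr_ge0 ?(ltW b0) // spectral_norm_ge0.
case: (hreg) => _ Lf _ _.
apply: sumr_ge0 => i _; have [Li _] := Lf i; have Bi := B_ge0 hreg i Dw0.
by rewrite addr_ge0 // !mulr_ge0 ?addr_ge0 ?(ltW b0).
Qed.

Lemma solver_lipschitz_ge0 : 0 <= Lphi.
Proof using hreg b0 Dw0.
by apply: le_trans solver_lipschitz_ge; case: hreg => -[].
Qed.

(** The feasible start [w0] gives the prox objective a finite value, so its minimizer lies in [domX]
    and the comparison can be read in the reals. *)
Lemma solver_argmin j : domX P (w j.+1) /\
  forall v, domX P v ->
    dot (grad phi (what j)) (w j.+1) + Lphi / 2 * enorm (w j.+1 - what j) ^+ 2
      + fine (ph P (w j.+1)) <=
    dot (grad phi (what j)) v + Lphi / 2 * enorm (v - what j) ^+ 2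
      + fine (ph P v).
Proof using hP Dw0 hN.
case: hN => _ _ _ /(_ j)[am _ _].
have ind v : domX P v -> eindicator (pX P) v = 0%E.
  by case=> _ Xv; rewrite /eindicator asboolT.
have hfin v : domX P v -> ph P v = (fine (ph P v))%:E := domX_fin hP (x:=v).
have Dw : domX P (w j.+1).
  have := am w0; rewrite (ind _ Dw0) (hfin _ Dw0) adde0.
  case: (hP) => _ _ _ [/(_ (w j.+1)) hw _] _.
  rewrite /domX /= /eindicator.
  by case: (ph P (w j.+1)) hw => [r| |] //= _;
    case: asboolP => // Xw _; split; rewrite //= ltry.
split=> // v Dv; have := am v.
by rewrite (ind _ Dw) (ind _ Dv) (hfin _ Dw) (hfin _ Dv) !adde0 -!EFinD lee_fin.
Qed.

Lemma solver_domX j : domX P (w j).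
Proof using hP Dw0 hN.
case: j => [|j]; first by case: hN => ->.
by case: (solver_argmin j).
Qed.

Lemma solver_prox_step j : extrapolation_region (domX P) (what j) ->
  prox_step (domX P) (al_val (P := P) (beta := beta) y z) Lphi mu (what j) (w j.+1).
Proof using hP hreg b0 Dw0 hsm hN.
move=> hr; have [Dw hw] := solver_argmin j.
have cD := segment_closed_domX hP.
have hG := al_gradient_ineq hP y z b0.
have mu0 : 0 <= mu by case: hP => _ [].
apply: (prox_stepP cD (convex_on_ph hP) hG Dw) => //.
rewrite -/phi.
have -> : phi (w j.+1) = phi (what j + (w j.+1 - what j)) by rewrite addrC subrK.
apply: descent_lemma; first exact: gradient_ineq_le mu0 hG.
move=> s s01; have [s0 s1] := andP s01.
set e := w j.+1 - what j.
have sE : what j + s *: e = s *: w j.+1 + (1 - s) *: what j.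
  by rewrite /e; apply/colP => i; rewrite !mxE; ring.
have -> : s * enorm e = enorm (what j + s *: e - what j).
  by rewrite [what j + _]addrC addrK enormZ ger0_norm.
have [Dh|nDh] := pselect (domX P (what j)).
  by apply: (al_lipschitz hP y z b0 hreg) => //; rewrite sE; exact: cD.
(* The differences are swapped because [smooth_at_extrapolated] wants the point outside [domX], here
   [what j], first. *)
rewrite enormB (enormB (what j + _)); apply: hsm => //.
have t01 : 0 <= 1 - s <= 1 by lra.
have := extrapolation_region_segment cD hr Dw t01.
by congr extrapolation_region; rewrite sE addrC subKr.
Qed.

Lemma extrapolation_region0 : extrapolation_region (domX P) (what 0%N).
Proof using Dw0 hN.
case: hN => _ -> _ _; exists w0, w0, 0.
by rewrite scale0r addr0; split=> //; rewrite lexx ler01.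
Qed.

Lemma extrapolation_regionS j t : 0 <= t <= 1 ->
  what j.+1 = w j.+1 + t *: (w j.+1 - w j) ->
  extrapolation_region (domX P) (what j.+1).
Proof using hP Dw0 hN.
by move=> t01 ->; exists (w j.+1), (w j), t; split=> //; apply: solver_domX.
Qed.

Lemma le_sqr_diam u v : domX P u -> domX P v -> enorm (u - v) ^+ 2 <= D ^+ 2.
Proof using hdom.
move=> Du Dv; have := le_diam hdom Du Dv => h.
by rewrite ler_pXn2r ?nnegrE ?enorm_ge0 // (le_trans (enorm_ge0 _) h).
Qed.

Lemma convex_on_al_val :
  forall u v t, domX P u -> domX P v -> 0 <= t <= 1 ->
    al_val (P := P) (beta := beta) y z (t *: u + (1 - t) *: v) <=
     t * al_val (P := P) (beta := beta) y z u
     + (1 - t) * al_val (P := P) (beta := beta) y z v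
       - mu / 2 * (t * (1 - t)) * enorm (u - v) ^+ 2.
Proof using hP b0.
move=> u v t Du Dv t01; rewrite /al_val.
have := gradient_ineq_conv u v (al_gradient_ineq hP y z b0) t01.
have := convex_on_ph hP Du Dv t01; lra.
Qed.

Lemma solver_rate_convex j x : mu = 0 -> domX P x ->
  al_val (P := P) (beta := beta) y z (w j.+1) <=
    al_val (P := P) (beta := beta) y z x
      + 2 * Lphi * D ^+ 2 / (j%:R + 2) ^+ 2.
Proof using hP hreg hdom b0 Dw0 hsm hN.
move=> mu0 Dx; have L0' := solver_lipschitz_ge0.
case: (hN) => w0E what0 a0 hrec; rewrite mu0 eqxx in a0.
have a01 i : 0 < alpha i <= 1.
  elim: i => [|i /andP[i0 i1]]; first by rewrite a0 ltr01 lexx.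
  have [_ hA _] := hrec i; have [p0] := alpha_recP i0 hA.
  rewrite mu0 !mul0r addr0 p0 /= => hE.
  (* [1 - alpha i.+1] has the sign of its product with [alpha i ^+ 2], which is a square. *)
  rewrite -subr_ge0 -(pmulr_lge0 _ (exprn_gt0 2 i0)) -hE; exact: sqr_ge0.
have aS i : alpha i.+1 ^+ 2 = (1 - alpha i.+1) * alpha i ^+ 2.
  have [_ hA _] := hrec i; have /andP[i0 _] := a01 i.
  by have [_] := alpha_recP i0 hA; rewrite mu0 !mul0r addr0.
have hatS i : what i.+1 = w i.+1 +
     (alpha i.+1 * (1 - alpha i) / alpha i) *: (w i.+1 - w i).
  have [_ _ ->] := hrec i; congr (_ + _ *: _).
  have /andP[i0 _] := a01 i; have /andP[j0 _] := a01 i.+1.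
  have q0 : 0 < alpha i ^+ 2 + alpha i.+1 by rewrite addr_gt0 // exprn_gt0.
  (* The two extrapolation factors differ by a multiple of the defect in the recursion [aS]. *)
  apply: subr0_eq; transitivity
    ((1 - alpha i) * ((1 - alpha i.+1) * alpha i ^+ 2 - alpha i.+1 ^+ 2)
      / (alpha i * (alpha i ^+ 2 + alpha i.+1))).
    by field; rewrite !gt_eqF.
  by rewrite aS subrr mulr0 mul0r.
have reg i : extrapolation_region (domX P) (what i).
  case: i => [|i]; first exact: extrapolation_region0.
  apply: extrapolation_regionS (hatS i).
  have /andP[i0 i1] := a01 i; have /andP[j0 j1] := a01 i.+1.
  rewrite divr_ge0 ?mulr_ge0 ?(ltW i0) ?(ltW j0) ?subr_ge0 //=.
  rewrite ler_pdivrMr // mul1r.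
  have ai : alpha i.+1 <= alpha i.
    rewrite -(ler_pXn2r (n := 2)) ?nnegrE ?(ltW i0) ?(ltW j0) //.
    by rewrite aS ler_piMl ?sqr_ge0 //; lra.
  by apply: le_trans ai; rewrite ler_piMr ?(ltW j0) //; lra.
have cF : convex_on (domX P) (al_val (P := P) (beta := beta) y z).
  move=> u v t Du Dv t01; have := convex_on_al_val Du Dv t01.
  by rewrite mu0 !mul0r subr0.
have w00 : what 0%N = w 0%N by rewrite what0 w0E.
have := fista_rate (segment_closed_domX hP) solver_domX Dx w00
  (fun i => solver_prox_step (reg i)) j mu0 L0' cF a0 a01 aS hatS.
have ha := fista_alpha_le j a0 a01 aS.
have /andP[j0 _] := a01 j.
have jj : 0 < j%:R + 2 :> R by rewrite ltr_wpDl.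
have h1 : alpha j ^+ 2 <= (2 / (j%:R + 2)) ^+ 2.
  by rewrite ler_pXn2r ?nnegrE ?(ltW j0) // divr_ge0 // ltW.
have h2 : Lphi / 2 * enorm (w 0%N - x) ^+ 2 <= Lphi / 2 * D ^+ 2.
  by rewrite ler_wpM2l ?divr_ge0 //; apply: le_sqr_diam => //; exact: solver_domX.
have h3 : alpha j ^+ 2 * (Lphi / 2 * enorm (w 0%N - x) ^+ 2) <=
   (2 / (j%:R + 2)) ^+ 2 * (Lphi / 2 * D ^+ 2).
  apply: ler_pM => //; first exact: sqr_ge0.
  by rewrite mulr_ge0 ?sqr_ge0 // divr_ge0.
have -> : 2 * Lphi * D ^+ 2 / (j%:R + 2) ^+ 2 =
   (2 / (j%:R + 2)) ^+ 2 * (Lphi / 2 * D ^+ 2) by field; rewrite gt_eqF.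
lra.
Qed.

Lemma solver_first_step x : domX P x ->
  al_val (P := P) (beta := beta) y z (w 1%N) <=
    al_val (P := P) (beta := beta) y z x + Lphi / 4 * D ^+ 2.
Proof using hP hreg hdom b0 Dw0 hN.
move=> Dx; have L0' := solver_lipschitz_ge0.
have [Dw hw] := solver_argmin 0.
have hG := al_gradient_ineq hP y z b0.
have mu0 : 0 <= mu by case: hP => _ [].
case: (hN) => _ what0 _ _; rewrite what0 in hw.
have := prox_first_step (segment_closed_domX hP) (convex_on_ph hP) L0'
  (gradient_ineq_le mu0 hG) (al_lipschitz hP y z b0 hreg) Dw0 Dw Dx hw.
rewrite -/phi /al_val => /le_trans; apply; rewrite lerD2l.
by rewrite ler_wpM2l ?divr_ge0 // le_sqr_diam.
Qed.

Lemma solver_rate_strong j x : 0 < mu -> mu <= Lphi -> domX P x ->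
  al_val (P := P) (beta := beta) y z (w j.+1) <=
    al_val (P := P) (beta := beta) y z x
      + (1 - Num.sqrt (mu / Lphi)) ^+ j.+1 * (Lphi * D ^+ 2).
Proof using hP hreg hdom b0 Dw0 hsm hN.
move=> mu0 muL Dx; have Lp : 0 < Lphi by exact: lt_le_trans muL.
case: (hN) => w0E what0 a0 hrec; rewrite gt_eqF // in a0.
set r := Num.sqrt (mu / Lphi) in a0 *.
have r0 : 0 < r by rewrite sqrtr_gt0 divr_gt0.
have r2 : r ^+ 2 = mu / Lphi by rewrite sqr_sqrtr // divr_ge0 // ltW.
have r1 : r <= 1.
  rewrite -(ler_pXn2r (n := 2)) ?nnegrE ?(ltW r0) // r2 expr1n.
  by rewrite ler_pdivrMr // mul1r.
(* Started at [r], with [r ^+ 2 = q], the recursion is stationary: under the root only [4 * r ^+ 2]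
   remains. *)
have ar i : alpha i = r.
  elim: i => [//|i IH]; have [_ -> _] := hrec i.
  rewrite IH r2 subrr expr0n /= !add0r -r2 sqrtrM // sqrtr_sqr (gtr0_norm r0).
  have -> : Num.sqrt 4 = 2 :> R.
    by rewrite (_ : 4 = 2 ^+ 2) ?sqrtr_sqr ?ger0_norm // -natrX.
  by field.
have hatS i : what i.+1 = w i.+1 + ((1 - r) / (1 + r)) *: (w i.+1 - w i).
  have [_ _ ->] := hrec i; rewrite !ar; congr (_ + _ *: _).
  field; apply/andP; split; apply: lt0r_neq0; rewrite // ?addr_gt0 ?exprn_gt0 //.
have reg i : extrapolation_region (domX P) (what i).
  case: i => [|i]; first exact: extrapolation_region0.
  apply: extrapolation_regionS (hatS i).
  by rewrite divr_ge0 ?ler_pdivrMr; lra.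
have w00 : what 0%N = w 0%N by rewrite what0 w0E.
have Lr : Lphi * r ^+ 2 = mu by rewrite r2 mulrC divfK // gt_eqF.
have r01 : 0 < r <= 1 by rewrite r0.
have := strongly_convex_rate (segment_closed_domX hP) solver_domX Dx w00
  (fun i => solver_prox_step (reg i)) j r01 Lr (ltW Lp) convex_on_al_val hatS.
have Dd u v : domX P u -> domX P v -> enorm (u - v) <= D by exact: le_diam.
have h1 : enorm (w 0%N - x) * enorm (w 1%N - w 0%N) <= D ^+ 2.
  by rewrite expr2 ler_pM ?enorm_ge0 //; apply: Dd => //; exact: solver_domX.
have h2 : (1 - r) ^+ j.+1 * (Lphi * (enorm (w 0%N - x) * enorm (w 1%N - w 0%N)))
   <= (1 - r) ^+ j.+1 * (Lphi * D ^+ 2).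
  rewrite ler_wpM2l ?exprn_ge0 ?subr_ge0 //.
  by rewrite ler_wpM2l // ltW.
lra.
Qed.

Context {e : R}.
Hypothesis e0 : 0 < e.

Let accurate_at i := accurate P beta y z e (w i).

Lemma accurate_solver i :
  (forall x, domX P x -> al_val (P := P) (beta := beta) y z (w i) <=
     al_val (P := P) (beta := beta) y z x + e) -> accurate_at i.
Proof using hP Dw0 hN.
by move=> h; apply/(accurateP hP y z e _ Dw0); split=> //; exact: solver_domX.
Qed.

Lemma diam_domX_ge0 : 0 <= D.
Proof using hdom Dw0. exact: le_trans (enorm_ge0 _) (le_diam hdom Dw0 Dw0). Qed.

(** The numerator of the rate is [e * s ^+ 2], so with [k] the integer part of [s] accuracy after
    [k + 1] steps follows from [s < k + 1 <= k + 2]. *)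
Lemma solver_count_convex : mu = 0 ->
  exists2 j : nat, accurate_at j & j%:R <= D * Num.sqrt (2 * Lphi / e) + 1.
Proof using hP hreg hdom b0 Dw0 hsm hN e0.
move=> mu0; have L0' := solver_lipschitz_ge0; have D0 := diam_domX_ge0.
set s := D * _.
have s0 : 0 <= s by rewrite mulr_ge0 // sqrtr_ge0.
have s2 : 2 * Lphi * D ^+ 2 = e * s ^+ 2.
  rewrite exprMn sqr_sqrtr; first by field; rewrite gt_eqF.
  by rewrite divr_ge0 ?(ltW e0) // mulr_ge0.
have := truncn_itv s0; set k := Num.truncn s => /andP[ks sk].
exists k.+1; last by rewrite -natr1 lerD2r.
apply: accurate_solver => x Dx; apply: (le_trans (solver_rate_convex k mu0 Dx)).
rewrite lerD2l s2 ler_pdivrMr ?exprn_gt0 ?ltr_wpDl // ler_wpM2l ?(ltW e0) //.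
rewrite ler_pXn2r ?nnegrE ?addr_ge0 // (le_trans (ltW sk)) // -natr1 lerD2l.
by rewrite ler1n.
Qed.

Lemma solver_count_strong : 0 < mu -> mu <= Lphi ->
  exists2 j : nat, accurate_at j &
    j%:R <= 2 * Num.sqrt (Lphi / mu) * lnp (D ^+ 2 * (Lphi + mu) / (2 * e)) + 1.
Proof using hP hreg hdom b0 Dw0 hsm hN e0.
move=> mu0 muL; have Lp : 0 < Lphi by exact: lt_le_trans muL.
have D0 := diam_domX_ge0.
set a := D ^+ 2 * _ / _; set s := 2 * _ * _.
have l0 : 0 <= lnp a by rewrite le_max lexx.
have q0 : 0 < Num.sqrt (Lphi / mu) by rewrite sqrtr_gt0 divr_gt0.
have s0 : 0 <= s by rewrite !mulr_ge0 // ltW.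
have := truncn_itv s0; set k := Num.truncn s => /andP[ks sk].
have r0 : 0 < Num.sqrt (mu / Lphi) by rewrite sqrtr_gt0 divr_gt0.
have rq : Num.sqrt (mu / Lphi) * Num.sqrt (Lphi / mu) = 1.
  rewrite -sqrtrM ?divr_ge0 ?ltW //.
  have -> : mu / Lphi * (Lphi / mu) = 1 by field; rewrite !gt_eqF.
  by rewrite sqrtr1.
set r := Num.sqrt (mu / Lphi) in r0 rq *.
pose X := expR (r * k.+1%:R / 2).
have X0 : 0 < X by exact: expR_gt0.
have aX : a < X.
  have lX : lnp a < r * k.+1%:R / 2.
    have : r * s < r * k.+1%:R by rewrite ltr_pM2l.
    have -> : r * s = 2 * lnp a.
      rewrite /s; transitivity (2 * (r * Num.sqrt (Lphi / mu)) * lnp a).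
        by ring.
      by rewrite rq mulr1.
    lra.
  (* For [a <= 0] the logarithm is a default value, and positivity of [X] suffices. *)
  have [a0|a0] := ltrP 0 a; last exact: le_lt_trans X0.
  rewrite -[a]lnK // /X ltr_expR; apply: le_lt_trans lX.
  by rewrite le_max lexx orbT.
have eX : D ^+ 2 * (Lphi + mu) < X * (2 * e) by rewrite -ltr_pdivrMr ?mulr_gt0.
have DL : D ^+ 2 * Lphi <= D ^+ 2 * (Lphi + mu).
  by rewrite ler_wpM2l ?sqr_ge0 // lerDl ltW.
(* If [X <= 2], then [D ^+ 2 * Lphi < 4 * e] and one step is enough. Otherwise the gap after [k + 1]
   steps is below [2 * e / X], hence below [e]. *)
have [X2|X2] := leP X 2.
  exists 1%N; last by rewrite lerDr.
  apply: accurate_solver => x Dx; apply: (le_trans (solver_first_step Dx)).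
  rewrite lerD2l; have : X * (2 * e) <= 2 * (2 * e).
    by rewrite ler_wpM2r // mulr_ge0 // ltW.
  lra.
exists k.+1; last by rewrite -natr1 lerD2r.
apply: accurate_solver => x Dx; apply: (le_trans (solver_rate_strong k mu0 muL Dx)).
rewrite lerD2l -/r.
have r1 : r <= 1.
  by rewrite -sqrtr1 ler_wsqrtr // ler_pdivrMr // mul1r.
have h1 : (1 - r) ^+ k.+1 <= (X * X)^-1.
  have -> : (X * X)^-1 = expR (- r) ^+ k.+1.
    by rewrite -expRM_natl -expRD -expRN; congr expR; rewrite -mulr_natl; field.
  rewrite ler_pXn2r ?nnegrE ?subr_ge0 ?expR_ge0 //.
  exact: expR_ge1Dx.
apply: (@le_trans _ _ ((X * X)^-1 * (D ^+ 2 * Lphi))).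
  by rewrite [Lphi * _]mulrC ler_wpM2r // mulr_ge0 ?sqr_ge0 // ltW.
rewrite mulrC ler_pdivrMr ?mulr_gt0 //.
apply: (le_trans DL); apply: (le_trans (ltW eX)).
by rewrite [leRHS]mulrCA ler_pM2l // [leRHS]mulrC ler_pM2r // ltW.
Qed.

End Solver.

(** * Complexity *)

Lemma ler_sqrtD (R : realType) (a b : R) : 0 <= a -> 0 <= b ->
  Num.sqrt (a + b) <= Num.sqrt a + Num.sqrt b.
Proof.
move=> a0 b0; rewrite -(ler_pXn2r (n := 2)) ?nnegrE ?addr_ge0 ?sqrtr_ge0 //.
rewrite sqrrD !sqr_sqrtr ?addr_ge0 // addrAC lerDl mulrn_wge0 // mulr_ge0.
Qed.

(** Monotone on all reals, because [ln] is 0 at nonpositive arguments. *)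
Lemma ler_lnp (R : realType) (a b : R) : a <= b -> lnp a <= lnp b.
Proof.
move=> ab; rewrite /lnp ge_max le_max lexx /=.
have [a0|a0] := ltrP 0 a; last by rewrite ln0 // le_max lexx.
by rewrite le_max ler_ln ?posrE ?ab ?orbT // (lt_le_trans a0).
Qed.

Lemma lnp_ge0 (R : realType) (a : R) : 0 <= lnp a.
Proof. by rewrite le_max lexx. Qed.

Lemma exists_first_index (Q : nat -> Prop) j :
  Q j -> exists2 i, first_index Q i & (i <= j)%N.
Proof.
move=> Qj; have ex : exists i, `[< Q i >] by exists j; apply/asboolP.
have [i /asboolP Qi mi] := ex_minnP ex.
exists i; last by apply: mi; apply/asboolP.
split=> // k ki Qk; have := mi k; rewrite asboolT // => /(_ isT).
by rewrite leqNgt ki.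
Qed.

Section Complexity.
Context {R : realType} {n p m : nat} {P : program R n p m} {mu L0 : R}
  {L B : 'I_m -> R} {xs : 'cV[R]_n} {ys : 'cV[R]_p} {zs : 'cV[R]_m}.
Hypothesis hP : convex_program P mu.
Hypothesis hreg : regularity_constants P L0 L B.
Hypothesis hkkt : kkt_point P xs ys zs.

Lemma H_const_ge0 : 0 <= H_const P L B.
Proof using hreg hkkt.
rewrite addr_ge0 ?spectral_norm_ge0 //; apply: sumr_ge0 => i _.
have Bi := B_ge0 hreg i (kkt_domX hkkt); case: hreg => _ /(_ i)[Li _] _ _.
by rewrite mulr_ge0 ?addr_ge0.
Qed.

Lemma Lstar_const_ge0 c : 0 <= Lstar_const L0 L ys zs c.
Proof using hreg.
case: hreg => -[L00 _] _ _ _.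
by rewrite addr_ge0 // mulr_ge0 ?addr_ge0 ?mulr_ge0 ?enorm_ge0 ?sqrtr_ge0.
Qed.

Lemma solver_lipschitz_le beta z :
  solver_lipschitz P L0 L B beta z <=
    L0 + beta * H_const P L B + enorm (\col_i L i) * enorm z.
Proof using.
rewrite /solver_lipschitz /H_const big_split /= mulrDr !addrA.
have -> : \sum_i beta * B i * (B i + L i) = beta * \sum_i B i * (B i + L i).
  by rewrite mulr_sumr; apply: eq_bigr => i _; rewrite mulrA.
rewrite lerD2l.
pose za := \col_i `|z i 0|.
have -> : \sum_i L i * `|z i 0| = dot (\col_i L i) za.
  by apply: eq_bigr => i _; rewrite !mxE.
have -> : enorm z = enorm za.
  rewrite /enorm; congr Num.sqrt; apply: eq_bigr => i _.
  by rewrite !mxE -normrM ger0_norm // -expr2 sqr_ge0.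
exact: dot_le_enorm.
Qed.

(** The root of the assumed bound is at most [enorm ys + enorm zs + Num.sqrt c]. The triangle
    inequality through [zs] adds the second copy of [enorm zs] found in [Lstar_const]. *)
Lemma solver_lipschitz_le_Lstar beta z c : 0 <= c ->
  enorm (z - zs) ^+ 2 <= c + enorm ys ^+ 2 + enorm zs ^+ 2 ->
  solver_lipschitz P L0 L B beta z <=
    Lstar_const L0 L ys zs c + beta * H_const P L B.
Proof using.
move=> c0 hz; apply: (le_trans (solver_lipschitz_le _ _)).
rewrite /Lstar_const addrAC lerD2r lerD2l ler_wpM2l ?enorm_ge0 //.
have y0 := enorm_ge0 ys; have z0 := enorm_ge0 zs.
have c0' : 0 <= Num.sqrt c by exact: sqrtr_ge0.
have h1 : enorm (z - zs) <= enorm ys + enorm zs + Num.sqrt c.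
  rewrite -(ler_pXn2r (n := 2)) ?nnegrE ?enorm_ge0 ?addr_ge0 //.
  apply: (le_trans hz); rewrite -{1}(sqr_sqrtr c0).
  have := mulr_ge0 y0 z0; have := mulr_ge0 y0 c0'; have := mulr_ge0 z0 c0'.
  nra.
have := ler_enormD (z - zs) zs; rewrite subrK; lra.
Qed.

Context {x0 : 'cV[R]_n} {K : nat} {eps Cbeta Ceps : R}.
Hypothesis hdom : bounded_set (domX P).
Hypothesis hx0 : domX P x0.
Hypothesis heps : 0 < eps.
Hypothesis hK : (0 < K)%N.
Hypothesis hCbeta : 0 < Cbeta.
Hypothesis hCeps : 0 < Ceps.

Let beta : R := Cbeta / (K%:R * eps).
Let e : R := eps / 2 * (Ceps / Cbeta).
Let D := diam (domX P).
Let H := H_const P L B.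
Let Lstar := Lstar_const L0 L ys zs Ceps.

Lemma K_gt0 : 0 < K%:R :> R. Proof using hK. by rewrite ltr0n. Qed.

Lemma beta_gt0 : 0 < beta.
Proof using hCbeta hK heps. by rewrite divr_gt0 // mulr_gt0 // ltr0n. Qed.

Lemma e_gt0 : 0 < e.
Proof using hCbeta hCeps heps. by rewrite mulr_gt0 // divr_gt0. Qed.

(** [2 * l / e] equals [4 * (Cbeta / Ceps) * (l / eps)], whence the leading 2, and subadditivity of
    the root separates [Lstar] from [beta * H]. *)
Lemma count_convex_le l : 0 <= l -> l <= Lstar + beta * H ->
  D * Num.sqrt (2 * l / e) <=
    2 * D * Num.sqrt (Cbeta / Ceps)
      * (Num.sqrt (Lstar / eps) + 1 / eps * Num.sqrt (Cbeta * H / K%:R)).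
Proof using hreg hkkt hdom hx0 heps hK hCbeta hCeps.
move=> l0 hl; have D0 : 0 <= D := diam_domX_ge0 hdom hx0.
have K0 := K_gt0; have H0 := H_const_ge0; have S0 := Lstar_const_ge0 Ceps.
rewrite [2 * D]mulrC -!mulrA ler_wpM2l //.
have -> : 2 * (l / e) = 2 ^+ 2 * ((Cbeta / Ceps) * (l / eps)).
  by rewrite /e; field; rewrite !gt_eqF.
rewrite sqrtrM ?sqr_ge0 // sqrtr_sqr ger0_norm // ler_pM2l //.
rewrite (sqrtrM _ (divr_ge0 (ltW hCbeta) (ltW hCeps))).
rewrite ler_pM2l ?sqrtr_gt0 ?divr_gt0 //.
apply: (@le_trans _ _ (Num.sqrt (Lstar / eps + beta * H / eps))).
  by rewrite ler_wsqrtr // -mulrDl ler_pM2r ?invr_gt0.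
apply: (le_trans (ler_sqrtD _ _)).
- by rewrite divr_ge0 // ltW.
- by rewrite divr_ge0 ?(ltW heps) // mulr_ge0 // ltW // beta_gt0.
rewrite lerD2l mul1r.
have -> : beta * H / eps = eps^-1 ^+ 2 * (Cbeta * (H / K%:R)).
  by rewrite /beta; field; rewrite !gt_eqF.
by rewrite sqrtrM ?sqr_ge0 // sqrtr_sqr ger0_norm // invr_ge0 ltW.
Qed.

Lemma count_strong_le l : 0 < mu -> 0 <= l -> l <= Lstar + beta * H ->
  2 * Num.sqrt (l / mu) * lnp (D ^+ 2 * (l + mu) / (2 * e)) <=
    2 * (Num.sqrt (Lstar / mu) + Num.sqrt (Cbeta * H / (mu * K%:R * eps)))
      * lnp (D ^+ 2 * Cbeta / Ceps
              * ((Lstar + mu) / eps + Cbeta * H / (K%:R * eps ^+ 2))).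
Proof using hreg hkkt hdom hx0 heps hK hCbeta hCeps.
move=> mu0 l0 hl; have K0 := K_gt0; have H0 := H_const_ge0.
have S0 := Lstar_const_ge0 Ceps.
apply: ler_pM; rewrite ?mulr_ge0 ?sqrtr_ge0 ?lnp_ge0 //.
  rewrite ler_pM2l //.
  apply: (@le_trans _ _ (Num.sqrt (Lstar / mu + beta * H / mu))).
    by rewrite ler_wsqrtr // -mulrDl ler_pM2r ?invr_gt0.
  have -> : Cbeta * H / (mu * K%:R * eps) = beta * H / mu.
    by rewrite /beta; field; rewrite !gt_eqF.
  apply: ler_sqrtD; first by rewrite divr_ge0 // ltW.
  by rewrite divr_ge0 ?(ltW mu0) // mulr_ge0 // ltW // beta_gt0.
apply: ler_lnp.
have -> : D ^+ 2 * Cbeta / Ceps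
      * ((Lstar + mu) / eps + Cbeta * H / (K%:R * eps ^+ 2))
   = D ^+ 2 * (Lstar + beta * H + mu) / (2 * e).
  by rewrite /beta /e; field; rewrite !gt_eqF.
have e2 : 0 < 2 * e := mulr_gt0 (ltr0n _ 2) e_gt0.
rewrite ler_pM2r ?invr_gt0 //.
by rewrite ler_wpM2l ?sqr_ge0 // lerD2r.
Qed.

Context {x : nat -> 'cV[R]_n} {y : nat -> 'cV[R]_p} {z : nat -> 'cV[R]_m}
  {w what : nat -> nat -> 'cV[R]_n} {alpha : nat -> nat -> R}.
Hypothesis muL : mu <= L0 / 4.
Hypothesis hrun : ialm_nesterov_run P mu L0 L B K (fun=> beta) (fun=> beta)
  (fun=> e) x0 0 0 x y z w what alpha.
Hypothesis hsm : forall k, (k < K)%N ->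
  smooth_at_extrapolated P L0 L B beta (y k) (z k).

Let acc k i := accurate P beta (y k) (z k) e (w k i).

(** Strong induction on the outer index. Accuracy of the earlier iterations bounds [z k], hence the
    Lipschitz constant of subproblem [k], hence the number of steps to an accurate iterate; the
    first accurate one comes no later. *)
Lemma inner_count k : (k < K)%N ->
  exists j, [/\ first_index (acc k) j, x k.+1 = w k j,
    mu = 0 -> j%:R <=
      2 * D * Num.sqrt (Cbeta / Ceps)
      * (Num.sqrt (Lstar / eps) + 1 / eps * Num.sqrt (Cbeta * H / K%:R)) + 1 &
    0 < mu -> j%:R <=
      2 * (Num.sqrt (Lstar / mu) + Num.sqrt (Cbeta * H / (mu * K%:R * eps)))
      * lnp (D ^+ 2 * Cbeta / Ceps
              * ((Lstar + mu) / eps + Cbeta * H / (K%:R * eps ^+ 2))) + 1].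
Proof using All.
have K0 := K_gt0; have b0 := beta_gt0; have e0 := e_gt0.
case: hrun => x0E y0E z0E hs.
elim/ltn_ind: k => k IH kK.
have run t : (t < k)%N ->
  [/\ accurate P beta (y t) (z t) e (x t.+1),
      y t.+1 = update_y P beta (y t) (x t.+1) &
      z t.+1 = update_z P beta beta (z t) (x t.+1)].
  move=> tk; have [_ _ hy hz] := hs t (ltn_trans tk kK).
  have [j [[hj _] xj _ _]] := IH t tk (ltn_trans tk kK).
  by split=> //; rewrite xj.
have Dxk : domX P (x k).
  case: k run {IH kK} => [|k] run; first by rewrite x0E.
  exact: (run_domX hP hkkt run).
have hl : solver_lipschitz P L0 L B beta (z k) <= Lstar + beta * H.
  apply: solver_lipschitz_le_Lstar; first exact: ltW.
  apply: (le_trans (run_z_bound hP hkkt b0 y0E z0E run)).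
  rewrite !lerD2r.
  (* The inexactness accumulated so far is the fraction [k / K] of the budget [Ceps]. *)
  have -> : 2 * (k%:R * (beta * e)) = (k%:R / K%:R) * Ceps.
    by rewrite /beta /e; field; rewrite !gt_eqF.
  by rewrite ler_piMl ?(ltW hCeps) // ler_pdivrMr // mul1r ler_nat ltnW.
have [hN hx _ _] := hs k kK.
have l0 := solver_lipschitz_ge0 hreg (z := z k) b0 Dxk.
have l1 := solver_lipschitz_ge hreg (z := z k) b0 Dxk.
have mu0 : 0 <= mu by case: hP => _ [].
have L00 : 0 <= L0 by case: hreg => -[].
have [m0|m0] := eqVneq mu 0.
  have [j hj jle] := solver_count_convex hP hreg hdom b0 Dxk (hsm kK) hN e0 m0.
  have [i hi ij] := @exists_first_index (acc k) j hj.
  exists i; split=> // [|_|]; first exact: hx.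
    have ij' : i%:R <= j%:R :> R by rewrite ler_nat.
    apply: (le_trans ij'); apply: (le_trans jle); rewrite lerD2r.
    exact: count_convex_le.
  by rewrite m0 ltxx.
have mp : 0 < mu by rewrite lt_def m0.
have ml : mu <= solver_lipschitz P L0 L B beta (z k).
  by apply: le_trans l1; move: muL L00; lra.
have [j hj jle] := solver_count_strong hP hreg hdom b0 Dxk (hsm kK) hN e0 mp ml.
have [i hi ij] := @exists_first_index (acc k) j hj.
exists i; split=> // [||_]; first exact: hx.
  by move=> m0'; rewrite m0' eqxx in m0.
have ij' : i%:R <= j%:R :> R by rewrite ler_nat.
apply: (le_trans ij'); apply: (le_trans jle); rewrite lerD2r.
exact: count_strong_le.
Qed.

End Complexity.

Lemma sum_le_ceil (R : realType) (K : nat) (J : nat -> nat) (s X : R) :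
  (forall k, (k < K)%N -> (J k)%:R <= s + 1) -> X = K%:R * s + K%:R ->
  (\sum_(k < K) J k)%:Z <= Num.ceil X.
Proof.
move=> hJ ->; rewrite -(ler_int R); apply: le_trans (ceil_ge _).
rewrite -pmulrn natr_sum -[X in _ * s + X]mulr1 -mulrDr mulr_natl.
rewrite -[X in _ *+ X]card_ord -sumr_const; apply: ler_sum => k _; exact: hJ.
Qed.

Unset Implicit Arguments.

Theorem theorem5 (R : realType) (n p m : nat) (P : program R n p m)
    (mu L0 : R) (L B : 'I_m -> R)
    (x0 xstar : 'cV[R]_n) (ystar : 'cV[R]_p) (zstar : 'cV[R]_m)
    (K : nat) (eps Cbeta Ceps : R)
    (beta := fun _ : nat => Cbeta / (K%:R * eps))
    (epsk := fun _ : nat => eps / 2 * (Ceps / Cbeta))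
    (D := diam (domX P))
    (H := H_const P L B)
    (Lstar := Lstar_const L0 L ystar zstar Ceps)
    (hP : convex_program P mu)
    (hdom : bounded_set (domX P))
    (hreg : regularity_constants P L0 L B)
    (hkkt : kkt_point P xstar ystar zstar)
    (hx0 : domX P x0)
    (heps : 0 < eps) (hK : (0 < K)%N) (hCbeta : 0 < Cbeta) (hCeps : 0 < Ceps) :
  (forall (x : nat -> 'cV[R]_n) (y : nat -> 'cV[R]_p) (z : nat -> 'cV[R]_m)
      (xbar := weighted_average K beta x),
    ialm_run P K beta beta epsk x0 0 0 x y z ->
    (`|objective P xbar - objective P xstar| <=
       (eps * (2 * enorm ystar ^+ 2 + 2 * enorm zstar ^+ 2) / Cbeta
        + eps / 2 * (Ceps / Cbeta))%:E)%E
    /\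
    enorm (pA P *m xbar - pb P) + enorm (pos_part (constraints P xbar)) <=
      eps * ((1 + enorm ystar) ^+ 2 + (1 + enorm zstar) ^+ 2) / (2 * Cbeta)
      + eps / 2 * (Ceps / Cbeta))
  /\
  (mu <= L0 / 4 ->
   forall (x : nat -> 'cV[R]_n) (y : nat -> 'cV[R]_p) (z : nat -> 'cV[R]_m)
      (w what : nat -> nat -> 'cV[R]_n) (alpha : nat -> nat -> R),
    ialm_nesterov_run P mu L0 L B K beta beta epsk x0 0 0 x y z w what alpha ->
    (forall k, (k < K)%N ->
      smooth_at_extrapolated P L0 L B (beta k) (y k) (z k)) ->
    exists J : nat -> nat,
      [/\ ialm_run P K beta beta epsk x0 0 0 x y z,
          forall k, (k < K)%N ->
            first_index
              (fun j => accurate P (beta k) (y k) (z k) (epsk k) (w k j)) (J k)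
            /\ x k.+1 = w k (J k),
          mu = 0 ->
            (\sum_(k < K) J k)%:Z <=
              Num.ceil (2 * D * K%:R * Num.sqrt (Cbeta / Ceps)
                * (Num.sqrt (Lstar / eps)
                   + 1 / eps * Num.sqrt (Cbeta * H / K%:R))
                + K%:R) &
          0 < mu ->
            (\sum_(k < K) J k)%:Z <=
              Num.ceil (2 * K%:R
                * (Num.sqrt (Lstar / mu)
                   + Num.sqrt (Cbeta * H / (mu * K%:R * eps)))
                * lnp (D ^+ 2 * Cbeta / Ceps
                      * ((Lstar + mu) / eps
                         + Cbeta * H / (K%:R * eps ^+ 2)))
                + K%:R)]).
Proof.
have b0 := beta_gt0 heps hK hCbeta; have K0 := K_gt0 (R := R) hK.
have Kb : K%:R * (Cbeta / (K%:R * eps)) = Cbeta / eps.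
  by field; rewrite !gt_eqF.
split.
  move=> x y z xbar [_ y0 z0 run].
  have [Db _] := ergodic_lagrangian hP hkkt b0 hK y0 z0 run.
  split.
    rewrite (objective_fobj hP Db) (objective_fobj hP (kkt_domX hkkt)) lee_fin.
    apply: (le_trans (ergodic_objective hP hkkt b0 hK y0 z0 run)).
    rewrite Kb addrC lerD2r le_eqVlt; apply/orP; left; apply/eqP.
    by field; rewrite !gt_eqF.
  apply: (le_trans (ergodic_infeasibility hP hkkt b0 hK y0 z0 run)).
  rewrite Kb addrC lerD2r le_eqVlt; apply/orP; left; apply/eqP.
  by field; rewrite !gt_eqF.
move=> muL x y z w what alpha hrun hsm.
have hc k (kK : (k < K)%N) := cid (inner_count hP hreg hkkt hdom hx0
  heps hK hCbeta hCeps muL hrun hsm kK).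
(* The chosen count depends on a proof of [k < K], so [J] is made total with value 0 elsewhere; [JE]
   recovers some proof for which the count applies. *)
pose J k := if pselect (k < K)%N is left h then projT1 (hc k h) else 0%N.
have hJ k (h : (k < K)%N) := projT2 (hc k h).
have JE k (h : (k < K)%N) : exists h', J k = projT1 (hc k h').
  by rewrite /J; case: pselect => // h'; exists h'.
exists J; split.
- case: hrun => hx hy hz hs; split=> // k kK.
  have [_ _ hy' hz'] := hs k kK; split=> //.
  by have [h' _] := JE k kK; have [[ha _] xE _ _] := hJ k h'; rewrite xE.
- move=> k kK; have [h' ->] := JE k kK; by have [ha xE _ _] := hJ k h'.
- move=> m0; apply: sum_le_ceil => [k kK|].
    by have [h' ->] := JE k kK; have [_ _ + _] := hJ k h'; exact.
  by rewrite /D /H /Lstar; ring.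
- move=> m0; apply: sum_le_ceil => [k kK|].
    by have [h' ->] := JE k kK; have [_ _ _ +] := hJ k h'; exact.
  by rewrite /D /H /Lstar; ring.
Qed.
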